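(* Let $n$ be a positive integer and $\mathcal H$ a complex Hilbert space. The joint numerical radius $w:B(\mathcal H)^{(n)}\to[0,\infty)$ satisfies, for all $(T_1,\ldots,T_n),(T_1',\ldots,T_n')\in B(\mathcal H)^{(n)}$, the following properties: (i) $w(T_1,\ldots,T_n)=0$ if and only if $T_1=\cdots=T_n=0$; (ii) $w(\lambda T_1,\ldots,\lambda T_n)=|\lambda|\,w(T_1,\ldots,T_n)$ for any $\lambda\in\mathbb C$; (iii) $w(T_1+T_1',\ldots,T_n+T_n')\le w(T_1,\ldots,T_n)+w(T_1',\ldots,T_n')$; (iv) $w(U^*T_1U,\ldots,U^*T_nU)=w(T_1,\ldots,T_n)$ for any Hilbert space $\mathcal K$ and any unitary operator $U:\mathcal K\to\mathcal H$; (v) $w(X^*T_1X,\ldots,X^*T_nX)\le\|X\|^2\,w(T_1,\ldots,T_n)$ for any Hilbert space $\mathcal K$ and any bounded operator $X:\mathcal K\to\mathcal H$; (vi) $\frac12\left\|\sum_{i=1}^nT_iT_i^*\right\|^{1/2}\le w(T_1,\ldots,T_n)\le\left\|\sum_{i=1}^nT_iT_i^*\right\|^{1/2}$; (vii) $r(T_1,\ldots,T_n)\le w(T_1,\ldots,T_n)$; (viii) $w(I_{\mathcal E}\otimes T_1,\ldots,I_{\mathcal E}\otimes T_n)=w(T_1,\ldots,T_n)$ for any separable Hilbert space $\mathcal E$; (ix) $w$ is a continuous map in the norm topology.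
   Context: All Hilbert spaces are complex and nonzero. $B(\mathcal H)$ is the algebra of bounded linear operators on $\mathcal H$ and $B(\mathcal H)^{(n)}$ the set of $n$-tuples of elements of $B(\mathcal H)$. $\mathbb F_n^+$ is the unital free semigroup on generators $g_1,\ldots,g_n$ with identity $g_0$; for $\alpha=g_{i_1}\cdots g_{i_k}$ put $|\alpha|=k$ and $T_\alpha=T_{i_1}\cdots T_{i_k}$, with $|g_0|=0$, $T_{g_0}=I$. Joint numerical radius: $$w(T_1,\ldots,T_n):=\sup\left|\sum_{\alpha\in\mathbb F_n^+}\sum_{j=1}^n\langle h_\alpha,T_jh_{g_j\alpha}\rangle\right|,$$ the supremum being over all families $\{h_\alpha\}_{\alpha\in\mathbb F_n^+}\subset\mathcal H$ with $\sum_{\alpha}\|h_\alpha\|^2=1$. Joint spectral radius: $r(T_1,\ldots,T_n):=\lim_{k\to\infty}\left\|\sum_{|\alpha|=k}T_\alpha T_\alpha^*\right\|^{1/2k}$. *)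

(* Defs.v *)
From HB Require Import structures.
From mathcomp Require Import all_boot all_order all_algebra.
From mathcomp Require Import sesquilinear complex.
From mathcomp Require Import all_classical all_reals all_analysis.
From mathcomp.analysis.showcase Require summability.

Set Implicit Arguments.
Unset Strict Implicit.
Unset Printing Implicit Defensive.

Import Order.TTheory GRing.Theory Num.Theory.
Import numFieldNormedType.Exports.
Local Open Scope classical_set_scope.
Local Open Scope ring_scope.

(* The norm of a normed space over R[i] takes its values in R[i]; [rnorm] is
   the same norm read in R (see [rnormE]). *)
Definition rnorm (R : realType) (V : normedZmodType R[i]) (x : V) : R :=
  complex.Re `|x|.

HB.mixin Record isHilbert (R : realType) H
    of CompleteNormedModule R[i] H := {
  inner : {dot H for @Num.conj R[i]} ;
  sqr_norm_inner : forall x : H, `|x| ^+ 2 = inner x x ;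
  hilbert_nonzero : exists x : H, x != 0
}.

#[short(type="hilbertType")]
HB.structure Definition Hilbert (R : realType) :=
  {H of CompleteNormedModule R[i] H & isHilbert R H}.

Section rnorm.
Variable R : realType.

Lemma rnormE (V : normedZmodType R[i]) (x : V) : `|x| = (rnorm x)%:C%C.
Proof. by rewrite /rnorm RRe_real// ger0_real. Qed.

Lemma rnorm_ge0 (V : normedZmodType R[i]) (x : V) : 0 <= rnorm x.
Proof. by rewrite -ler0c -rnormE. Qed.

Lemma ler_rnormD (V : normedZmodType R[i]) (x y : V) :
  rnorm (x + y) <= rnorm x + rnorm y.
Proof. by rewrite -lecR rmorphD/= -!rnormE ler_normD. Qed.

Lemma rnormZ (V : normedModType R[i]) (a : R[i]) (x : V) :
  rnorm (a *: x) = rnorm a * rnorm x.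
Proof.
apply: complexI; rewrite rmorphM/= -!rnormE; exact: normrZ.
Qed.

Lemma rnorm0 (V : normedZmodType R[i]) : rnorm (0 : V) = 0.
Proof. by rewrite /rnorm normr0. Qed.

Lemma rnorm0_eq0 (V : normedZmodType R[i]) (x : V) : rnorm x = 0 -> x = 0.
Proof. by move=> x0; apply/normr0_eq0; rewrite rnormE x0. Qed.

End rnorm.

Section bounded_operators.
Variables (R : realType) (K H : normedModType R[i]).

Definition bounded_op : {pred K -> H} := mem
  [set f | linear f /\ exists M : R, forall x, rnorm (f x) <= M * rnorm x].

Definition bounded_op_key : pred_key bounded_op. Proof. exact. Qed.
Canonical bounded_op_keyed := KeyedPred bounded_op_key.

Lemma bounded_opP f : f \in bounded_op <->
  linear f /\ exists M : R, forall x, rnorm (f x) <= M * rnorm x.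
Proof. by split; [move/set_mem | move/mem_set]. Qed.

Lemma bounded_op_submod : submod_closed bounded_op.
Proof.
split=> [|a f g /bounded_opP[fl [M fM]] /bounded_opP[gl [N gN]]].
  apply/bounded_opP; split; first by move=> a x y /=; rewrite scaler0 addr0.
  by exists 0 => x; rewrite /= rnorm0 mul0r.
apply/bounded_opP; split=> [b x y|].
  rewrite /= -![(a *: f + g) _]/(a *: f _ + g _) fl gl.
  by rewrite !scalerDr !scalerA mulrC addrACA.
exists (rnorm a * M + N) => x; rewrite -[(a *: f + g) _]/(a *: f _ + g _).
rewrite (le_trans (ler_rnormD _ _))// mulrDl lerD// rnormZ -mulrA.
by rewrite ler_wpM2l ?rnorm_ge0.
Qed.

HB.instance Definition _ :=
  GRing.isSubmodClosed.Build R[i] (K -> H) bounded_op bounded_op_submod.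

Record bop := Bop { bop_fun :> K -> H ; bop_prop : bop_fun \in bounded_op }.

HB.instance Definition _ := [isSub for bop_fun].
HB.instance Definition _ := [Choice of bop by <:].
HB.instance Definition _ := [SubChoice_isSubLmodule of bop by <:].

Lemma bopP (S T : bop) : S =1 T -> S = T.
Proof. by move=> ST; apply/val_inj/funext. Qed.

Lemma bop_linear (T : bop) : linear T.
Proof. by have /bounded_opP[] := bop_prop T. Qed.

HB.instance Definition _ (T : bop) :=
  GRing.isLinear.Build R[i] K H *:%R (bop_fun T) (bop_linear T).

Lemma bop_bounded (T : bop) :
  exists M : R, forall x, rnorm (T x) <= M * rnorm x.
Proof. by have /bounded_opP[] := bop_prop T. Qed.

Definition opnorm (T : bop) : R :=
  sup [set rnorm (T x) | x in [set x | rnorm x <= 1]].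

Lemma has_sup_opnorm (T : bop) :
  has_sup [set rnorm (T x) | x in [set x | rnorm x <= 1]].
Proof.
have [M TM] := bop_bounded T; split.
  by exists (rnorm (T 0)), 0 => //=; rewrite rnorm0.
exists `|M| => _ [x /= x1 <-]; rewrite (le_trans (TM x))//.
rewrite (le_trans (ler_norm _))// normrM ler_piMr//.
by rewrite ger0_norm ?rnorm_ge0.
Qed.

Lemma opnorm_ge0 (T : bop) : 0 <= opnorm T.
Proof.
rewrite -(rnorm0 H); apply: ub_le_sup; first by case: (has_sup_opnorm T).
by exists 0; rewrite /= ?rnorm0// linear0 rnorm0.
Qed.

Lemma ler_opnorm (T : bop) x : rnorm (T x) <= opnorm T * rnorm x.
Proof.
have [->|x0] := eqVneq x 0; first by rewrite linear0 !rnorm0 mulr0.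
have xgt0 : 0 < rnorm x.
  rewrite lt_neqAle rnorm_ge0 andbT eq_sym; apply: contra_neq x0.
  exact: rnorm0_eq0.
rewrite -ler_pdivrMr//.
have rV : rnorm ((rnorm x)^-1%:C%C : R[i]) = (rnorm x)^-1.
  by rewrite /rnorm ger0_norm// lecR invr_ge0 rnorm_ge0.
apply: ub_le_sup; first by case: (has_sup_opnorm T).
exists ((rnorm x)^-1%:C%C *: x).
  by rewrite /= rnormZ rV mulVf ?gt_eqF.
by rewrite linearZ/= rnormZ rV mulrC.
Qed.

Lemma opnorm_le (T : bop) (M : R) : 0 <= M ->
  (forall x, rnorm (T x) <= M * rnorm x) -> opnorm T <= M.
Proof.
move=> M0 TM; apply: ge_sup; first by case: (has_sup_opnorm T).
by move=> _ [x /= x1 <-]; rewrite (le_trans (TM x))// ler_piMr.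
Qed.

Let ler_opnormD (S T : bop) :
  (opnorm (S + T))%:C%C <= (opnorm S)%:C%C + (opnorm T)%:C%C :> R[i].
Proof.
rewrite -rmorphD lecR; apply: opnorm_le; first by rewrite addr_ge0 ?opnorm_ge0.
move=> x; rewrite -[(S + T) x]/(S x + T x) (le_trans (ler_rnormD _ _))//.
by rewrite mulrDl lerD ?ler_opnorm.
Qed.

Let opnormZ_le (a : R[i]) (T : bop) : opnorm (a *: T) <= rnorm a * opnorm T.
Proof.
apply: opnorm_le => [|x]; first by rewrite mulr_ge0 ?opnorm_ge0 ?rnorm_ge0.
by rewrite -[(a *: T) x]/(a *: T x) rnormZ -mulrA ler_wpM2l ?rnorm_ge0 ?ler_opnorm.
Qed.

Let opnorm0_eq0 (T : bop) : (opnorm T)%:C%C = 0 :> R[i] -> T = 0.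
Proof.
move=> /complexI T0; apply/bopP => x; apply/rnorm0_eq0/le_anti.
by rewrite rnorm_ge0 (le_trans (ler_opnorm _ _))// T0 mul0r.
Qed.

Let opnormZ (a : R[i]) (T : bop) :
  (opnorm (a *: T))%:C%C = `|a| * (opnorm T)%:C%C :> R[i].
Proof.
rewrite rnormE -rmorphM; congr (_ %:C)%C; apply/le_anti.
rewrite opnormZ_le/=; have [->|a0] := eqVneq a 0.
  by rewrite rnorm0 mul0r opnorm_ge0.
have := opnormZ_le a^-1 (a *: T); rewrite scalerA mulVf// scale1r.
have agt0 : 0 < rnorm a by rewrite -ltcR -rnormE normr_gt0.
suff -> : rnorm a^-1 = (rnorm a)^-1 by rewrite mulrC ler_pdivlMr// mulrC.
by apply: complexI; rewrite fmorphV/= -!rnormE normfV.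
Qed.

HB.instance Definition _ :=
  Lmodule_isNormed.Build R[i] bop ler_opnormD opnormZ opnorm0_eq0.

Lemma opnormE (T : bop) : rnorm T = opnorm T.
Proof. by []. Qed.

End bounded_operators.

Notation "{ 'bop' K -> H }" := (bop K H)
  (K at level 98, H at level 99, format "{ 'bop'  K  ->  H }") : type_scope.

Section composition.
Variables (R : realType).

Lemma bop_id_proof (H : normedModType R[i]) : (@id H) \in @bounded_op R H H.
Proof. by apply/bounded_opP; split=> //; exists 1 => x; rewrite mul1r. Qed.

Definition bop_id (H : normedModType R[i]) : {bop H -> H} :=
  Bop (bop_id_proof H).

Lemma bop_comp_proof (K H G : normedModType R[i])
  (S : {bop H -> G}) (T : {bop K -> H}) : S \o T \in @bounded_op R K G.
Proof.
apply/bounded_opP; split=> [a x y|]; first by rewrite /= !linearP.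
exists (opnorm S * opnorm T) => x /=.
by rewrite (le_trans (ler_opnorm _ _))// -mulrA ler_wpM2l ?opnorm_ge0 ?ler_opnorm.
Qed.

Definition bop_comp (K H G : normedModType R[i])
  (S : {bop H -> G}) (T : {bop K -> H}) : {bop K -> G} :=
  Bop (bop_comp_proof S T).

End composition.

Notation "S \oB T" := (bop_comp S T)
  (at level 40, left associativity, format "S  \oB  T") : ring_scope.

(* There is at most one operator S as below, and one exists by the Riesz
   representation theorem. *)
Definition adjoint (R : realType) (K H : hilbertType R) (T : {bop K -> H}) :
    {bop H -> K} :=
  xget 0 [set S : {bop H -> K} | forall x y, inner (T x) y = inner x (S y)].

Definition unitary (R : realType) (K H : hilbertType R) (U : {bop K -> H}) :=
  adjoint U \oB U = bop_id K /\ U \oB adjoint U = bop_id H.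

Definition separable (T : topologicalType) :=
  exists2 D : set T, countable D & dense D.

(* (G, tau) is a Hilbert space tensor product of E and H, tau e h being the
   simple tensor of e and h; it is determined by E and H up to a unique unitary
   operator preserving simple tensors. *)
Definition is_tensor_product (R : realType) (E H G : hilbertType R)
    (tau : {bilinear E -> H -> G}) :=
  (forall e e' h h', inner (tau e h) (tau e' h') = inner e e' * inner h h') /\
  dense [set g : G | exists s : seq (E * H), g = \sum_(p <- s) tau p.1 p.2].

(* The operator of G sending each simple tensor of e and h to that of A e and
   B h: it exists and is unique when (G, tau) is a tensor product. *)
Definition tensor_op (R : realType) (E H G : hilbertType R)
    (tau : {bilinear E -> H -> G}) (A : {bop E -> E}) (B : {bop H -> H}) :
    {bop G -> G} :=
  xget 0 [set S : {bop G -> G} | forall e h, S (tau e h) = tau (A e) (B h)].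

Section joint_radii.
Variables (R : realType) (H : hilbertType R) (n : nat).
Implicit Types T : 'I_n -> {bop H -> H}.

(* The free semigroup on n generators is [seq 'I_n] with concatenation: the
   identity is [::], the length is [size], and g_j alpha is [j :: alpha]. *)
Definition word_op T (a : seq 'I_n) : {bop H -> H} :=
  foldr (fun j S => T j \oB S) (bop_id H) a.

(* The sum over words is the limit of the net of its finite partial sums. *)
Definition word_form T (h : seq 'I_n -> H) : R[i] :=
  summability.sum
    (fun a => \sum_(j < n) inner (h a) (T j (h (j :: a))) : R[i]^o).

Definition joint_numerical_values T : set R :=
  [set rnorm (word_form T h) | h in
    [set h : seq 'I_n -> H |
      (\esum_(a in [set: seq 'I_n]) (rnorm (h a) ^+ 2)%:E)%E = 1%E]].

Definition joint_numerical_radius T : R := sup (joint_numerical_values T).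

Definition joint_spectral_seq T (k : nat) : R :=
  rnorm (\sum_(a : k.-tuple 'I_n) word_op T a \oB adjoint (word_op T a))
    `^ (2 * k%:R)^-1.

Definition joint_spectral_radius T : R := limn (joint_spectral_seq T).

End joint_radii.

(* Main.v *)
(* Write w for the joint numerical radius. The partial sums of the defining
   form over words of length < N bound it on both sides: w is the least M >= 0
   such that, for all N and h, the form truncated to |a| < N is at most
   M * sum_(|a| <= N) |h_a|^2 in modulus. Everything is then proved for finite
   sums.

   (vi) The upper bound is Cauchy-Schwarz for the column (T_j^* )_j; the lower
   bound is the family h_1 = x, h_{g_j} = c T_j^* x with the best c.
   (vii) For h_a = c_{|a|} T_{rev a}^* x and s_k = sum_(|a| = k) |T_a^* x|^2, the
   form is sum_k c_k c_{k+1} s_{k+1}. With c_k = s_k^(-1/2) the truncation at N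
   gives sum_(k < N) (s_{k+1} / s_k)^(1/2) <= w (N + 1), and the inequality of
   arithmetic and geometric means bounds s_N^(1/2N) by w (N + 1) / N. Convergence
   of the spectral sequence is Fekete's lemma.
   (viii) Finitely many finite sums of simple tensors can be written over a common
   orthonormal family of E, along which the form and the mass split; simple
   tensors being total, this suffices.
   (iv) follows from (v), and (ix) from (iii) and (vi). *)
Require Import Defs.
From mathcomp Require Import all_boot all_order all_algebra.
From mathcomp Require Import sesquilinear complex.
From mathcomp Require Import all_classical all_reals all_analysis.
From mathcomp Require Import finmap ring lra.
Import Order.TTheory GRing.Theory Num.Theory.
Import numFieldNormedType.Exports.
Local Open Scope classical_set_scope.
Local Open Scope ring_scope.

Set Implicit Arguments.
Unset Strict Implicit.

(** * Inner products *)

Section hilbert_space.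
Context {R : realType}.
Local Notation C := R[i].
Local Notation Re := complex.Re.
Implicit Types H : hilbertType R.

Lemma ReD (a b : C) : Re (a + b) = Re a + Re b. Proof. by case: a b => ? ? []. Qed.
Lemma ReN (a : C) : Re (- a) = - Re a. Proof. by case: a. Qed.
Lemma ReZ (t : R) (a : C) : Re (t%:C%C * a) = t * Re a.
Proof. by case: a => x y /=; rewrite mul0r subr0. Qed.

Lemma Re_le_rnorm (a : C) : Re a <= rnorm a.
Proof.
by rewrite -lecR -rnormE (le_trans _ (normc_ge_Re a))// lecR ler_norm.
Qed.

Lemma rnormM (a b : C) : rnorm (a * b) = rnorm a * rnorm b.
Proof. by apply: complexI; rewrite rmorphM/= -!rnormE normrM. Qed.

Lemma rnorm_real (t : R) : 0 <= t -> rnorm (t%:C%C : C) = t.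
Proof. by move=> t0; apply: complexI; rewrite -rnormE ger0_norm// lecR. Qed.

Lemma rnorm_conj (a : C) : rnorm a^* = rnorm a.
Proof. by apply: complexI; rewrite -!rnormE norm_conjC. Qed.

Lemma sqr_rnorm (a : C) : (rnorm a ^+ 2)%:C%C = a * a^*.
Proof. by rewrite rmorphXn/= -rnormE normCK. Qed.

Lemma rnormN (V : normedZmodType C) (x : V) : rnorm (- x) = rnorm x.
Proof. by rewrite /rnorm normrN. Qed.

Lemma rnorm_distC (V : normedZmodType C) (x y : V) : rnorm (x - y) = rnorm (y - x).
Proof. by rewrite /rnorm distrC. Qed.

Lemma rnorm_eq0 (V : normedZmodType C) (x : V) : (rnorm x == 0) = (x == 0).
Proof.
by apply/eqP/eqP => [/rnorm0_eq0//|->]; rewrite rnorm0.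
Qed.

Lemma rnorm_gt0 (V : normedZmodType C) (x : V) : (0 < rnorm x) = (x != 0).
Proof. by rewrite lt_def rnorm_eq0 rnorm_ge0 andbT. Qed.

Lemma rnorm_sum (V : normedZmodType C) (I : Type) (s : seq I) (P : pred I)
    (F : I -> V) :
  rnorm (\sum_(i <- s | P i) F i) <= \sum_(i <- s | P i) rnorm (F i).
Proof.
elim/big_rec2: _ => [|i x y _ h]; first by rewrite rnorm0.
by rewrite (le_trans (ler_rnormD _ _))// lerD2l.
Qed.

Section inner.
Variable H : hilbertType R.
Implicit Types x y z : H.

Lemma innerDl x y z : inner (x + y) z = inner x z + inner y z.
Proof. by rewrite linearDl. Qed.
Lemma innerDr x y z : inner z (x + y) = inner z x + inner z y.
Proof. by rewrite linearDr. Qed.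
Lemma innerNl x z : inner (- x) z = - inner x z.
Proof. by rewrite linearNl. Qed.
Lemma innerNr x z : inner z (- x) = - inner z x.
Proof. by rewrite linearNr. Qed.
Lemma innerZl (a : C) x z : inner (a *: x) z = a * inner x z.
Proof. by rewrite linearZl_LR. Qed.
Lemma innerZr (a : C) x z : inner z (a *: x) = a^* * inner z x.
Proof. by rewrite linearZr_LR. Qed.
Lemma inner0l z : inner 0 z = 0 :> C. Proof. by rewrite linear0l. Qed.
Lemma inner0r z : inner z 0 = 0 :> C. Proof. by rewrite linear0r. Qed.
Lemma innerC x y : inner y x = (inner x y)^* :> C.
Proof. by rewrite (hermC (@inner R H) y x) expr0 mul1r. Qed.

Lemma inner_suml (I : Type) (s : seq I) (P : pred I) (F : I -> H) z :
  inner (\sum_(i <- s | P i) F i) z = \sum_(i <- s | P i) inner (F i) z.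
Proof.
by elim/big_rec2: _ => [|i x y _ <-]; rewrite ?inner0l ?innerDl.
Qed.

Lemma inner_sumr (I : Type) (s : seq I) (P : pred I) (F : I -> H) z :
  inner z (\sum_(i <- s | P i) F i) = \sum_(i <- s | P i) inner z (F i).
Proof.
by elim/big_rec2: _ => [|i x y _ <-]; rewrite ?inner0r ?innerDr.
Qed.

Lemma innerxx x : inner x x = (rnorm x ^+ 2)%:C%C.
Proof. by rewrite -sqr_norm_inner rnormE -rmorphXn. Qed.

Lemma Re_innerC x y : Re (inner y x) = Re (inner x y).
Proof. by rewrite innerC; case: (inner x y). Qed.

Lemma rnormD_sqr x y :
  rnorm (x + y) ^+ 2 = rnorm x ^+ 2 + rnorm y ^+ 2 + 2 * Re (inner x y).
Proof.
apply: complexI; rewrite -innerxx innerDl !innerDr !innerxx (innerC x y).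
by case: (inner x y) => a b; apply/eqP; rewrite eq_complex /=; apply/andP; split; apply/eqP; ring.
Qed.

Lemma rnormB_sqr x y :
  rnorm (x - y) ^+ 2 = rnorm x ^+ 2 + rnorm y ^+ 2 - 2 * Re (inner x y).
Proof. by rewrite rnormD_sqr rnormN innerNr ReN mulrN. Qed.

Lemma parallelogram x y :
  rnorm (x + y) ^+ 2 + rnorm (x - y) ^+ 2 = 2 * (rnorm x ^+ 2 + rnorm y ^+ 2).
Proof. by rewrite rnormD_sqr rnormB_sqr; ring. Qed.

Lemma cauchy_schwarz x y : rnorm (inner x y) <= rnorm x * rnorm y.
Proof.
have [->|y0] := eqVneq y 0; first by rewrite inner0r !rnorm0 mulr0.
have ygt0 : 0 < rnorm y ^+ 2 by rewrite exprn_gt0 ?rnorm_gt0.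
rewrite -ler_sqr ?nnegrE ?mulr_ge0 ?rnorm_ge0// exprMn.
(* [u] is [rnorm y ^+ 2] times the component of [x] orthogonal to [y]; its squared norm is, up to a
   positive factor, the gap in the inequality. *)
set u := inner y y *: x - inner x y *: y.
have uy : inner u y = 0 by rewrite /u innerDl innerNl !innerZl mulrC subrr.
suff : (rnorm u ^+ 2) =
    rnorm y ^+ 2 * (rnorm x ^+ 2 * rnorm y ^+ 2 - rnorm (inner x y) ^+ 2).
  move=> h; rewrite -subr_ge0 -(pmulr_rge0 _ ygt0) -h; exact: sqr_ge0.
apply: complexI; rewrite -innerxx [in X in inner _ X]/u innerDr innerNr !innerZr.
rewrite uy mulr0 subr0 /u innerDl innerNl !innerZl (innerC x y).
have rM (a b : R) : (a * b)%:C%C = a%:C%C * b%:C%C :> C by exact: rmorphM.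
have rB (a b : R) : (a - b)%:C%C = a%:C%C - b%:C%C :> C by exact: rmorphB.
by rewrite -innerC rM rB (rM (rnorm x ^+ 2)) sqr_rnorm -!innerxx [inner x x * _]mulrC.
Qed.

Lemma inner_inj x y : (forall z, inner z x = inner z y) -> x = y.
Proof.
move=> xy; apply/eqP; rewrite -subr_eq0 -rnorm_eq0 -sqrf_eq0; apply/eqP.
by apply: complexI; rewrite -innerxx innerDr innerNr xy subrr.
Qed.

End inner.
End hilbert_space.

(** * Riesz representation and adjoints *)

Section riesz.
Context {R : realType}.
Local Notation C := R[i].
Local Notation Re := complex.Re.

(** Completeness restated with real radii, since the uniform structure of [V] has its radii in
    [C]. *)
Lemma cauchy_rnorm_cvg (V : completeNormedModType C) (u : nat -> V) :
  (forall e : R, 0 < e -> exists N, forall m n, (N <= m)%N -> (N <= n)%N ->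
     rnorm (u m - u n) < e) ->
  exists l, forall e : R, 0 < e -> exists N, forall n, (N <= n)%N ->
     rnorm (u n - l) < e.
Proof.
move=> cu; have : cauchy (u @ \oo).
  apply/cauchy_exP => e e0.
  have eR : e = (Re e)%:C%C by rewrite RRe_real// ger0_real// ltW.
  have [|N uN] := cu (Re e); first by rewrite -ltcR -eR.
  exists (u N); exists N => // n /= Nn.
  by rewrite -ball_normE /= eR rnormE ltcR; apply: uN.
move/cauchy_cvg => /cvg_ex[l ul]; exists l => e e0.
have e0' : 0 < e%:C%C :> C by rewrite ltcR.
have /cvgrPdist_lt/(_ _ e0') := ul.
case=> N _ h; exists N => n Nn.
by rewrite rnorm_distC; have := h n Nn; rewrite rnormE ltcR.
Qed.

Lemma sqr_ltW (a e : R) : 0 < e -> a ^+ 2 < e ^+ 2 -> a < e.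
Proof.
move=> e0 h; have [a0|a0] := ltP a 0; first exact: lt_trans e0.
by rewrite -ltr_sqr ?nnegrE// ltW.
Qed.

Lemma half_rnorm (V : normedModType C) (x : V) : rnorm ((2^-1)%:C%C *: x) = 2^-1 * rnorm x.
Proof. by rewrite rnormZ rnorm_real. Qed.

(* The representing vector minimizes [fun x => rnorm x ^+ 2 - 2 * Re (f x)]; a
   minimizing sequence is Cauchy by the parallelogram law. *)
Lemma riesz (H : hilbertType R) (f : H -> C) (M : R) :
  linear_for *%R f -> (forall x, rnorm (f x) <= M * rnorm x) ->
  exists y, forall x, f x = inner x y.
Proof.
move=> fl fM.
have fD x y : f (x + y) = f x + f y by rewrite -[x]scale1r fl mul1r scale1r.
have f0 : f 0 = 0 by apply: (addrI (f 0)); rewrite -fD !addr0.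
have fZ a x : f (a *: x) = a * f x by rewrite -[a *: x]addr0 fl f0 addr0.
pose J x := rnorm x ^+ 2 - 2 * Re (f x).
have Jlb x : - M ^+ 2 <= J x.
  rewrite /J; have := Re_le_rnorm (f x); have := fM x.
  by have := sqr_ge0 (rnorm x - M); nra.
have hasJ : has_inf (range J).
  by split; [exists (J 0), 0|exists (- M ^+ 2) => _ [x _ <-]].
pose d := inf (range J).
have dJ x : d <= J x by apply: ge_inf; [case: hasJ|exists x].
(* [d] lies below [J] at the midpoint of [x] and [y], so near-minimizers are close to each other. *)
have Jmid x y : rnorm (x - y) ^+ 2 <= 2 * (J x - d) + 2 * (J y - d).
  have := dJ ((2^-1)%:C%C *: (x + y)); have := parallelogram x y.
  rewrite {1}/J half_rnorm exprMn fZ ReZ fD ReD /J; lra.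
have xk k : exists x, J x < d + k.+1%:R^-1.
  have [|_ [x _ <-] h] := inf_adherent (_ : 0 < k.+1%:R^-1 :> R) hasJ.
    by rewrite invr_gt0.
  by exists x.
have [u uP] := choice xk.
have [|y yP] := @cauchy_rnorm_cvg H u.
  move=> e e0; have e20 : 0 < e ^+ 2 / 4 by rewrite divr_gt0// exprn_gt0.
  have [N NP] : exists N : nat, forall k, (N <= k)%N -> k.+1%:R^-1 < e ^+ 2 / 4.
    exists (Num.truncn ((e ^+ 2 / 4)^-1)) => k Nk.
    rewrite invf_plt ?posrE// (lt_le_trans (truncnS_gt _))// ler_nat.
    by rewrite ltnS.
  exists N => m n Nm Nn; apply: sqr_ltW => //.
  have := Jmid (u m) (u n); have := uP m; have := uP n.
  have := NP _ Nm; have := NP _ Nn.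
  move: (n.+1%:R^-1) (m.+1%:R^-1) => a b; lra.
(* The infimum is attained at the limit: near [y], [J] drops below [J y] at most linearly in the
   distance. *)
have Jy : J y = d.
  apply/le_anti; rewrite dJ andbT; apply/ler_addgt0Pr => e e0.
  have [K K0 KP] : exists2 K : R, 0 < K &
     forall z, rnorm (z - y) <= 1 -> J y <= J z + K * rnorm (z - y).
    exists (2 * rnorm y + 2 * `|M| + 1).
      by have := rnorm_ge0 y; have := normr_ge0 M; lra.
    move=> z zy; have zE : z = y + (z - y) by rewrite addrC subrK.
    rewrite {2}/J zE fD ReD rnormD_sqr -zE /J.
    have := cauchy_schwarz y (z - y); have := Re_le_rnorm (- inner y (z - y)).
    rewrite ReN rnormN; have := fM (z - y); have := Re_le_rnorm (f (z - y)).
    have := ler_norm M; have := rnorm_ge0 (z - y); have := sqr_ge0 (rnorm (z - y)).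
    by nra.
  have [|N1 N1P] := yP (Order.min 1 (e / 2 / K)).
    by rewrite lt_min ltr01 !divr_gt0.
  pose N := maxn N1 (Num.truncn ((e / 2)^-1)).
  have := N1P N (leq_maxl _ _); rewrite lt_min => /andP[/ltW h1 h2].
  have := KP _ h1; have := uP N.
  have : N.+1%:R^-1 < e / 2.
    rewrite invf_plt ?posrE ?divr_gt0// (lt_le_trans (truncnS_gt _))// ler_nat.
    by rewrite ltnS leq_maxr.
  by move: (N.+1%:R^-1) => a; rewrite ltr_pdivlMr// mulrC in h2; lra.
have Ref x : Re (f x) = Re (inner x y).
  apply/eqP; rewrite -subr_eq0; apply/eqP.
  set b := _ - _.
  (* Minimality of [y] along the line y + t x; the linear term of this nonnegative quadratic, a
     multiple of [b], must vanish. *)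
  have key t : 0 <= t ^+ 2 * rnorm x ^+ 2 - 2 * t * b.
    have := dJ (y + t%:C%C *: x); rewrite -Jy /J rnormD_sqr fD fZ ReD ReZ.
    rewrite Re_innerC innerZl ReZ rnormZ exprMn.
    have -> : rnorm (t%:C%C : C) ^+ 2 = t ^+ 2.
      by rewrite /rnorm normc_def /= expr0n addr0 sqrtr_sqr real_normK ?num_real.
    by rewrite /b; lra.
  apply/eqP; apply: contraT => b0.
  have q0 : 0 < rnorm x ^+ 2 + 1 by rewrite ltr_wpDl// sqr_ge0.
  (* This value of [t] makes the quadratic negative unless [b = 0]; the [+ 1] covers [x = 0]. *)
  have := key (b / (rnorm x ^+ 2 + 1)).
  have -> : (b / (rnorm x ^+ 2 + 1)) ^+ 2 * rnorm x ^+ 2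
      - 2 * (b / (rnorm x ^+ 2 + 1)) * b =
    - (b ^+ 2 / (rnorm x ^+ 2 + 1) ^+ 2) * (rnorm x ^+ 2 + 2).
    by field; rewrite gt_eqF.
  rewrite mulNr oppr_ge0 leNgt mulr_gt0//.
    by rewrite divr_gt0 ?(exprn_gt0 _ q0)// exprn_even_gt0.
  by rewrite ltr_wpDl// sqr_ge0.
(* The real part of f (i x) is minus the imaginary part of f x. *)
exists y => x; have := Ref ('i%C *: x); have := Ref x.
rewrite fZ innerZl; case: (f x) (inner x y) => a b [a' b'] /= ->.
by rewrite !mul0r !mul1r !sub0r => /oppr_inj ->.
Qed.
End riesz.

Section adjoint.
Context {R : realType}.
Local Notation C := R[i].
Implicit Types H K G : hilbertType R.

(** [xget] returns an operator with this property as soon as one exists. [riesz] gives the vectors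
    [S y], and |S y|^2 = <T (S y), y> bounds [S] by [opnorm T]. *)
Lemma adjointP K H (T : {bop K -> H}) x y : inner (T x) y = inner x (adjoint T y).
Proof.
rewrite /adjoint; case: xgetP => [S _ /= ->//|noS]; exfalso.
have /choice[S SP] : forall y, exists z, forall x, inner (T x) y = inner x z.
  move=> {}y; apply: (@riesz _ _ _ (opnorm T * rnorm y)) => [a u v|u].
    by rewrite linearP innerDl innerZl.
  rewrite (le_trans (cauchy_schwarz _ _))// mulrAC ler_wpM2r ?rnorm_ge0//.
  exact: ler_opnorm.
have Sb : S \in @bounded_op R H K.
  apply/bounded_opP; split=> [a u v|].
    by apply: inner_inj => z; rewrite -SP !innerDr !innerZr !SP.
  exists (opnorm T) => u; have [->|u0] := eqVneq (S u) 0.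
    by rewrite rnorm0 mulr_ge0 ?opnorm_ge0 ?rnorm_ge0.
  rewrite -(ler_pM2r (_ : 0 < rnorm (S u))) ?rnorm_gt0// -expr2.
  have -> : rnorm (S u) ^+ 2 = rnorm (inner (T (S u)) u).
    by rewrite SP innerxx rnorm_real ?sqr_ge0.
  rewrite (le_trans (cauchy_schwarz _ _))// mulrAC ler_wpM2r ?rnorm_ge0//.
  exact: ler_opnorm.
by apply: (noS (Bop Sb)) => u v; rewrite /= SP.
Qed.

Lemma adjointPr K H (T : {bop K -> H}) x y : inner x (T y) = inner (adjoint T x) y.
Proof. by rewrite innerC adjointP -innerC. Qed.

Lemma adjointK K H (T : {bop K -> H}) : adjoint (adjoint T) = T.
Proof. by apply/bopP => x; apply: inner_inj => z; rewrite -adjointP adjointPr. Qed.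

Lemma adjoint_comp K H G (S : {bop H -> G}) (T : {bop K -> H}) :
  adjoint (S \oB T) = adjoint T \oB adjoint S.
Proof. by apply/bopP => x; apply: inner_inj => z; rewrite -!adjointP. Qed.

Lemma adjoint_id H : adjoint (bop_id H) = bop_id H.
Proof. by apply/bopP => x; apply: inner_inj => z; rewrite -adjointP. Qed.

End adjoint.

(** * Sums over words *)

Section words.
Variable n : nat.
Local Notation word := (seq 'I_n).

Definition level (k : nat) : seq word := [seq tval t | t <- enum {: k.-tuple 'I_n}].
Definition words (N : nat) : seq word := flatten [seq level k | k <- iota 0 N].

Lemma mem_level k (a : word) : (a \in level k) = (size a == k).
Proof.
apply/mapP/eqP => [[t _ ->]|<-]; first by rewrite size_tuple.
by exists (in_tuple a); rewrite ?mem_enum.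
Qed.

Lemma level_uniq k : uniq (level k).
Proof. by rewrite map_inj_uniq ?enum_uniq//; exact: val_inj. Qed.

Lemma mem_words N (a : word) : (a \in words N) = (size a < N)%N.
Proof.
apply/flatten_mapP/idP => [[k]|aN].
  by rewrite mem_iota/= mem_level => kN /eqP ->.
by exists (size a); rewrite ?mem_iota ?mem_level.
Qed.

Lemma wordsS N : words N.+1 = words N ++ level N.
Proof. by rewrite /words -addn1 iotaD map_cat flatten_cat /= cats0. Qed.

Lemma words_uniq N : uniq (words N).
Proof.
elim: N => // N IH; rewrite wordsS cat_uniq IH level_uniq andbT/=.
by apply/hasPn => a; rewrite mem_level mem_words => /eqP ->; rewrite ltnn.
Qed.

(** The first letter is split off, rather than the last, because the form pairs [h a] with
    [h (j :: a)]. *)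
Lemma perm_levelS k :
  perm_eq (level k.+1) [seq j :: a | a <- level k, j <- enum 'I_n].
Proof.
apply: uniq_perm; first exact: level_uniq.
  by apply: allpairs_uniq; [exact: level_uniq|exact: enum_uniq|]; move=> [a i] [b j] _ _ /= [-> ->].
move=> a; rewrite mem_level; apply/eqP/allpairsP => [|[[b j]]/=].
  by case: a => // j a [ak]; exists (a, j); rewrite /= mem_level ak eqxx mem_enum.
by rewrite mem_level => -[/eqP <- _ ->].
Qed.

Lemma perm_wordsS N :
  perm_eq (words N.+1) ([::] :: [seq j :: a | a <- words N, j <- enum 'I_n]).
Proof.
apply: uniq_perm; first exact: words_uniq.
  rewrite /= allpairs_uniq ?words_uniq ?enum_uniq ?andbT//.
    by apply/allpairsP => -[[b j]] /= [].
  by move=> [a i] [b j] _ _ /= [-> ->].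
move=> a; rewrite mem_words inE; case: a => [|j a] //=; rewrite ltnS.
apply/idP/allpairsP => [aN|[[b i]]/= []].
  by exists (a, j); rewrite /= mem_words mem_enum.
by rewrite mem_words => bN _ [_ ->].
Qed.

Section sums.
Variables (V : nmodType) (F : word -> V).

Lemma big_levelS k :
  \sum_(a <- level k.+1) F a = \sum_(a <- level k) \sum_(j < n) F (j :: a).
Proof.
rewrite (perm_big _ (perm_levelS k)) big_allpairs_dep /=.
by apply: eq_bigr => a _; rewrite big_enum.
Qed.

Lemma big_wordsS N :
  \sum_(a <- words N.+1) F a =
  F [::] + \sum_(a <- words N) \sum_(j < n) F (j :: a).
Proof.
rewrite (perm_big _ (perm_wordsS N)) big_cons big_allpairs_dep /=; congr (_ + _).
by apply: eq_bigr => a _; rewrite big_enum.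
Qed.

Lemma big_words_level N :
  \sum_(a <- words N) F a = \sum_(k < N) \sum_(a <- level k) F a.
Proof.
elim: N => [|N IH]; first by rewrite big_nil big_ord0.
by rewrite wordsS big_cat big_ord_recr /= IH.
Qed.

Lemma big_level_tuple k :
  \sum_(a <- level k) F a = \sum_(t : k.-tuple 'I_n) F t.
Proof. by rewrite big_map big_enum. Qed.

Lemma big_level0 : \sum_(a <- level 0) F a = F [::].
Proof.
by rewrite big_level_tuple (big_pred1 [tuple])// => t; rewrite (tuple0 t) /= eqxx.
Qed.

End sums.

(** Cofinality of the [words N] among finite sets of words: bounds on them pass to limits along the
    net of finite sets. *)
Lemma fsub_words (A : {fset word}) : exists N, {subset A <= words N}.
Proof.
exists (\max_(a <- A) size a).+1 => a aA; rewrite mem_words ltnS.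
exact: leq_bigmax_seq.
Qed.

Definition fwords N : {fset word} := [fset a in words N]%fset.

Lemma big_fwords (V : nmodType) (F : word -> V) N :
  \sum_(a <- fwords N) F a = \sum_(a <- words N) F a.
Proof.
apply: perm_big; apply: uniq_perm; [exact: fset_uniq|exact: words_uniq|].
by move=> a; rewrite inE.
Qed.

End words.

(** * Infinite sums over words *)

Section word_sums.
Context {R : realType}.
Local Notation C := R[i].
Variable n : nat.
Local Notation word := (seq 'I_n).

Lemma partial_sum_words (x : word -> C^o) N :
  summability.partial_sum x (fwords n N) = \sum_(a <- words n N) x a.
Proof. by rewrite /summability.partial_sum -big_fwords big_seq_fsetE. Qed.

Lemma point_complex : (point : C^o) = 0.
Proof. by []. Qed.

(* If the net of partial sums diverged, its [lim] would be the junk value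
   [point = 0], for which the bound is trivial. *)
Lemma sum_word_le (x : word -> C^o) (M : R) : 0 <= M ->
  (forall N, rnorm (\sum_(a <- words n N) x a) <= M) ->
  rnorm (summability.sum x) <= M.
Proof.
move=> M0 xM; rewrite /summability.sum.
set F := (X in lim X).
have PT := @summability.totally_filter word.
have PF : ProperFilter F by exact: fmap_proper_filter.
have [/cvg_ex[l Fl]|dF] := pselect (cvg F); last first.
  by rewrite (dvgP dF) point_complex rnorm0.
have -> : lim F = l by exact: (cvg_lim (@norm_hausdorff _ _) Fl).
apply/ler_addgt0Pr => e e0.
have e0' : 0 < e%:C%C :> C by rewrite ltcR.
have /cvgrPdist_lt/(_ _ e0')[A _ AP] := Fl.
(* Any finite set containing [A] has a partial sum close to [l], and [words n N] is such a set. *)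
have [N AN] := fsub_words A.
have := AP (fwords n N) _; rewrite /= partial_sum_words rnormE ltcR => h.
have {}h := h _; rewrite -[l](subrK (\sum_(a <- words n N) x a)).
rewrite (le_trans (ler_rnormD _ _))// addrC lerD//; apply/ltW/h.
by apply/fsubsetP => a /AN aN; rewrite inE.
Qed.

(** The partial sums are constant once the index set contains [fwords n N]. *)
Lemma sum_word_finite (x : word -> C^o) N :
  (forall a, (N <= size a)%N -> x a = 0) ->
  summability.sum x = \sum_(a <- words n N) x a.
Proof.
move=> x0; rewrite /summability.sum.
have PF := @summability.totally_filter word.
apply: cvg_lim => //; apply: cvg_near_cst.
exists (fwords n N) => // A /= NA.
rewrite -big_fwords /summability.partial_sum -(big_seq_fsetE _ _ predT x)/=.
apply/eqP; rewrite (big_fsetID _ (mem (fwords n N)))/= [X in _ + X]big_seq_cond [X in _ + X]big1 ?addr0.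
  apply/eqP; apply: eq_fbigl => a; rewrite !inE.
  by apply/andP/idP => [[]//|aN]; split=> //; apply: (fsubsetP NA); rewrite inE.
by move=> a; rewrite !inE andbT mem_words -leqNgt => /andP[_]; exact: x0.
Qed.

Lemma sum_le_esum (f : word -> R) N : (forall a, 0 <= f a) ->
  ((\sum_(a <- words n N) f a)%:E <= \esum_(a in [set: word]) (f a)%:E)%E.
Proof.
move=> f0; apply: esum_ge; exists [set` fwords n N].
  by split; [exact: finite_fset|].
by rewrite fsbig_finite// set_fsetK big_fwords sumEFin.
Qed.

Lemma esum_finite (f : word -> R) N : (forall a, 0 <= f a) ->
  (forall a, (N <= size a)%N -> f a = 0) ->
  (\esum_(a in [set: word]) (f a)%:E = (\sum_(a <- words n N) f a)%:E)%E.
Proof.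
move=> f0 fN; rewrite -big_fwords -sumEFin.
transitivity (\esum_(a in [set` fwords n N]) (f a)%:E)%E.
  rewrite [RHS]esum_mkcond; apply: eq_esum => a _; case: ifPn => //.
  by rewrite notin_setE /= inE /= mem_words => /negP; rewrite -leqNgt => /fN ->.
rewrite esum_fset//; last by move=> a _; rewrite lee_fin.
by rewrite fsbig_finite// set_fsetK.
Qed.

End word_sums.

(** * Truncated forms *)

Section truncated_forms.
Context {R : realType} {n : nat}.
Local Notation C := R[i].
Local Notation word := (seq 'I_n).

Definition form_upto (H : hilbertType R) (T : 'I_n -> {bop H -> H})
    (h : word -> H) (N : nat) : C :=
  \sum_(a <- words n N) \sum_(j < n) inner (h a) (T j (h (j :: a))).

Definition mass_upto (H : hilbertType R) (h : word -> H) (N : nat) : R :=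
  \sum_(a <- words n N) rnorm (h a) ^+ 2.

(** Both sides are quadratic in [h], which replaces the normalization to unit mass. The mass runs
    one level further than the form because the form over words of length less than [N] involves [h]
    up to length [N]. *)
Definition form_bounded (H : hilbertType R) (T : 'I_n -> {bop H -> H}) (M : R) :=
  forall (h : word -> H) N, rnorm (form_upto T h N) <= M * mass_upto h N.+1.

Section radius.
Variables (H : hilbertType R) (T : 'I_n -> {bop H -> H}).
Implicit Types (h : word -> H) (M s : R).
Local Notation values := (joint_numerical_values T).
Local Notation w := (joint_numerical_radius T).

Lemma mass_upto_ge0 h N : 0 <= mass_upto h N.
Proof. by apply: sumr_ge0 => a _; exact: sqr_ge0. Qed.

Lemma mass_uptoS h N : mass_upto h N.+1 =
  rnorm (h [::]) ^+ 2 + \sum_(a <- words n N) \sum_(j < n) rnorm (h (j :: a)) ^+ 2.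
Proof. by rewrite /mass_upto big_wordsS. Qed.

Lemma mass_upto_le h N : mass_upto h N <= mass_upto h N.+1.
Proof.
rewrite /mass_upto wordsS big_cat /= lerDl.
by apply: sumr_ge0 => a _; exact: sqr_ge0.
Qed.

Lemma values_le M : 0 <= M -> form_bounded T M -> ubound values M.
Proof.
move=> M0 TM _ [h /= h1 <-]; apply: sum_word_le => // N.
apply: (le_trans (TM h N)); apply: ler_piMr => //.
rewrite -lee_fin -h1; apply: (sum_le_esum (f := fun a => rnorm (h a) ^+ 2)) => a.
exact: sqr_ge0.
Qed.

(** Both infinite sums reduce to finite ones: the terms of the form at words of length [N] already
    vanish, since they involve [h (j :: a)]. *)
Lemma unit_values h N : mass_upto h N.+1 = 1 ->
  (forall a, (N < size a)%N -> h a = 0) -> values (rnorm (form_upto T h N)).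
Proof.
move=> h1 hN; exists h => /=.
  rewrite (@esum_finite _ _ (fun a => rnorm (h a) ^+ 2) N.+1) => [|a|a aN].
  - by congr (_%:E).
  - exact: sqr_ge0.
  - by rewrite hN// rnorm0 expr0n.
rewrite /word_form (@sum_word_finite _ _ _ N)// => a aN.
by apply: big1 => j _; rewrite (hN (j :: a))// linear0 inner0r.
Qed.

(** The [sup] of an empty set would be a default value. A unit vector at the empty word excludes
    this; it exists by [hilbert_nonzero]. *)
Lemma values_nonempty : values !=set0.
Proof.
have [x x0] := @hilbert_nonzero R H.
have xgt0 : 0 < rnorm x by rewrite rnorm_gt0.
pose h (a : word) : H := if a is [::] then (rnorm x)^-1%:C%C *: x else 0.
exists (rnorm (form_upto T h 0)); apply: unit_values => [|[|]//].
rewrite mass_uptoS big_nil addr0 /= rnormZ rnorm_real ?invr_ge0 ?rnorm_ge0//.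
by rewrite mulVf ?gt_eqF// expr1n.
Qed.

Lemma form_bounded_has_sup M : 0 <= M -> form_bounded T M -> has_sup values.
Proof.
by move=> M0 TM; split; [exact: values_nonempty|exists M; exact: values_le].
Qed.

Lemma radius_le M : 0 <= M -> form_bounded T M -> w <= M.
Proof.
by move=> M0 TM; apply: ge_sup; [exact: values_nonempty|exact: values_le].
Qed.

(** Cutting [h] off after length [N] and scaling it to unit mass gives an admissible family, whose
    value is the truncated form of [h] divided by the mass. *)
Lemma form_bounded_radius : has_sup values -> form_bounded T w.
Proof.
move=> hs h N; have [m0|m0] := eqVneq (mass_upto h N.+1) 0.
  (* Without mass, [h] vanishes on all words of length at most [N], and the form with it. *)
  rewrite m0 mulr0 /form_upto big_seq big1 ?rnorm0// => a.
  rewrite mem_words => aN; apply: big1 => j _.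
  have : rnorm (h a) ^+ 2 <= 0.
    rewrite -m0 /mass_upto (bigD1_seq a) ?words_uniq ?mem_words ?ltnS 1?ltnW//=.
    by rewrite lerDl sumr_ge0// => b _; exact: sqr_ge0.
  by rewrite exprn_even_le0//= rnorm_eq0 => /eqP ->; rewrite inner0l.
have m_gt0 : 0 < mass_upto h N.+1 by rewrite lt_def m0 mass_upto_ge0.
set m := mass_upto h N.+1 in m0 m_gt0 *.
pose c := Num.sqrt m^-1.
have c0 : 0 <= c by exact: sqrtr_ge0.
have cE : c ^+ 2 = m^-1 by rewrite sqr_sqrtr// invr_ge0 ltW.
pose h' (a : word) : H := if (size a <= N)%N then c%:C%C *: h a else 0.
have h'E : mass_upto h' N.+1 = 1.
  rewrite -(mulVf m0) -cE /m /mass_upto mulr_sumr; apply: eq_big_seq => a.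
  by rewrite mem_words ltnS /h' => ->; rewrite rnormZ exprMn rnorm_real.
have : rnorm (form_upto T h' N) <= w.
  apply: ub_le_sup; first by case: hs.
  by apply: unit_values => // a; rewrite ltnNge /h' => /negbTE ->.
have -> : form_upto T h' N = (c ^+ 2)%:C%C * form_upto T h N.
  rewrite /form_upto mulr_sumr; apply: eq_big_seq => a.
  rewrite mem_words => aN; rewrite mulr_sumr; apply: eq_bigr => j _.
  rewrite /h' /= aN (ltnW aN) linearZ/= innerZl innerZr mulrA; congr (_ * _).
  by rewrite rmorphXn/= expr2; congr (_ * _); rewrite conj_Creal// complex_real.
by rewrite rnormM rnorm_real ?sqr_ge0// cE mulrC ler_pdivrMr.
Qed.

(** For [s >= 0], this says that the column of the [adjoint (T j)], equivalently the row of the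
    [T j], has norm at most [s]. *)
Definition column_bounded s :=
  forall x, \sum_(j < n) rnorm (adjoint (T j) x) ^+ 2 <= s ^+ 2 * rnorm x ^+ 2.

(** After Cauchy-Schwarz, p q <= p^2 / (2s) + s q^2 / 2 is applied to each term. Each half is at
    most s / 2 times the mass: [h a] runs over lengths below [N], [h (j :: a)] over lengths 1 to
    [N]. *)
Lemma column_form_bounded s : 0 <= s -> column_bounded s -> form_bounded T s.
Proof.
move=> s0 Ts h N.
pose f a j := rnorm (adjoint (T j) (h a)) * rnorm (h (j :: a)).
have -> : form_upto T h N =
    \sum_(a <- words n N) \sum_(j < n) inner (adjoint (T j) (h a)) (h (j :: a)).
  by apply: eq_bigr => a _; apply: eq_bigr => j _; rewrite adjointPr.
apply: (@le_trans _ _ (\sum_(a <- words n N) \sum_(j < n) f a j)).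
  rewrite (le_trans (rnorm_sum _ _ _))//; apply: ler_sum => a _.
  rewrite (le_trans (rnorm_sum _ _ _))//; apply: ler_sum => j _.
  exact: cauchy_schwarz.
(* The weights divide by [s], so [s = 0] is treated apart; the adjoints then vanish at each
   [h a]. *)
have [sz|s_gt0] := eqVneq s 0.
  rewrite big1 ?mulr_ge0 ?mass_upto_ge0// => a _.
  have := Ts (h a); rewrite sz expr0n mul0r => le0.
  have /eqP : \sum_(j < n) rnorm (adjoint (T j) (h a)) ^+ 2 = 0.
    by apply/le_anti; rewrite le0 sumr_ge0// => j _; exact: sqr_ge0.
  rewrite psumr_eq0 => [/allP h0|j _]; last exact: sqr_ge0.
  apply: big1 => j _; have := h0 j; rewrite mem_index_enum sqrf_eq0.
  by move=> /(_ isT)/eqP; rewrite /f => ->; rewrite mul0r.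
have {}s_gt0 : 0 < s by rewrite lt_def s_gt0.
apply: (@le_trans _ _ (\sum_(a <- words n N) (s / 2 * rnorm (h a) ^+ 2 +
     s / 2 * \sum_(j < n) rnorm (h (j :: a)) ^+ 2))).
  apply: ler_sum => a _.
  apply: (@le_trans _ _ (\sum_(j < n) ((2 * s)^-1 * rnorm (adjoint (T j) (h a)) ^+ 2
      + s / 2 * rnorm (h (j :: a)) ^+ 2))).
    apply: ler_sum => j _; rewrite /f.
    set p := rnorm (adjoint _ _); set q := rnorm _.
    rewrite -subr_ge0.
    have -> : (2 * s)^-1 * p ^+ 2 + s / 2 * q ^+ 2 - p * q =
       (2 * s)^-1 * (p - s * q) ^+ 2 by field; rewrite gt_eqF.
    by rewrite mulr_ge0 ?sqr_ge0// invr_ge0 mulr_ge0// ltW.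
  rewrite big_split /= -!mulr_sumr lerD2r.
  apply: (@le_trans _ _ ((2 * s)^-1 * (s ^+ 2 * rnorm (h a) ^+ 2))).
    by rewrite ler_wpM2l ?Ts// invr_ge0 mulr_ge0// ltW.
  by rewrite le_eqVlt; apply/orP; left; apply/eqP; field; rewrite gt_eqF.
rewrite big_split /= -!mulr_sumr.
have := mass_upto_le h N; have := mass_uptoS h N; rewrite /mass_upto.
set A := \sum_(a <- _) _; set B := \sum_(a <- _) _; set D := \sum_(a <- _) _.
have := sqr_ge0 (rnorm (h [::])); nra.
Qed.

Lemma radius_column_bounded M : 0 <= M -> form_bounded T M -> column_bounded (2 * M).
Proof.
move=> M0 TM x; set S := \sum_(j < n) _.
have S0 : 0 <= S by apply: sumr_ge0 => j _; exact: sqr_ge0.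
have key (c : R) : 0 <= c -> c * S <= M * (rnorm x ^+ 2 + c ^+ 2 * S).
  move=> c0.
  pose h (a : word) : H := match a with
    | [::] => x | [:: j] => c%:C%C *: adjoint (T j) x | _ => 0 end.
  have := TM h 1%N; rewrite mass_uptoS /form_upto !big_wordsS !big_nil !addr0 /= => h1.
  have E1 : \sum_(j < n) inner x (T j (c%:C%C *: adjoint (T j) x)) = (c * S)%:C%C.
    rewrite /S mulr_sumr rmorph_sum; apply: eq_bigr => j _.
    rewrite adjointPr innerZr innerxx conj_Creal ?complex_real//.
    by rewrite -rmorphM.
  have E2 : \sum_(j < n) rnorm (c%:C%C *: adjoint (T j) x) ^+ 2 = c ^+ 2 * S.
    by rewrite mulr_sumr; apply: eq_bigr => j _; rewrite rnormZ exprMn rnorm_real.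
  by move: h1; rewrite E1 E2 rnorm_real// mulr_ge0.
have [->|S_neq0] := eqVneq S 0; first by rewrite mulr_ge0 ?sqr_ge0.
have S_gt0 : 0 < S by rewrite lt_def S_neq0.
have [Mz|M_neq0] := eqVneq M 0.
  by have := key 1 ler01; rewrite Mz mul1r; lra.
have M_gt0 : 0 < M by rewrite lt_def M_neq0.
(* c = 1 / (2M) maximizes c - M c^2 and leaves S / (4M) <= M |x|^2. *)
have := key (2 * M)^-1; rewrite invr_ge0 mulr_ge0// => /(_ isT) k.
rewrite -subr_ge0; have M4 : 0 < 4 * M by rewrite mulr_gt0.
rewrite -(pmulr_rge0 _ (_ : 0 < (4 * M)^-1)) ?invr_gt0//.
have -> : (4 * M)^-1 * ((2 * M) ^+ 2 * rnorm x ^+ 2 - S) =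
  M * (rnorm x ^+ 2 + (2 * M)^-1 ^+ 2 * S) - (2 * M)^-1 * S.
  by field; rewrite gt_eqF.
by rewrite subr_ge0.
Qed.

End radius.

End truncated_forms.

(** * Norm properties of the joint numerical radius *)

Section rows.
Context {R : realType}.
Local Notation C := R[i].

Lemma bop_sumE (K H : hilbertType R) (I : Type) (s : seq I) (P : pred I)
    (F : I -> {bop K -> H}) x :
  (\sum_(i <- s | P i) F i) x = \sum_(i <- s | P i) F i x.
Proof. by elim/big_rec2: _ => // i y z _ <-. Qed.

Lemma rnorm_adjoint (K H : hilbertType R) (T : {bop K -> H}) :
  rnorm (adjoint T) <= rnorm T.
Proof.
apply: opnorm_le => [|y]; first exact: opnorm_ge0.
have [->|Ty] := eqVneq (adjoint T y) 0.
  by rewrite rnorm0 mulr_ge0 ?opnorm_ge0 ?rnorm_ge0.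
rewrite -(ler_pM2r (_ : 0 < rnorm (adjoint T y))) ?rnorm_gt0// -expr2.
have -> : rnorm (adjoint T y) ^+ 2 = rnorm (inner (T (adjoint T y)) y).
  by rewrite adjointP innerxx rnorm_real ?sqr_ge0.
rewrite (le_trans (cauchy_schwarz _ _))// mulrAC ler_wpM2r ?rnorm_ge0//.
exact: ler_opnorm.
Qed.

Variables (H : hilbertType R) (I : finType) (F : I -> {bop H -> H}).
Local Notation A := (\sum_(i : I) F i \oB adjoint (F i)).

Lemma column_le_rnorm x :
  \sum_(i : I) rnorm (adjoint (F i) x) ^+ 2 <= rnorm A * rnorm x ^+ 2.
Proof.
have E : inner (A x) x = (\sum_(i : I) rnorm (adjoint (F i) x) ^+ 2)%:C%C.
  rewrite bop_sumE inner_suml rmorph_sum; apply: eq_bigr => i _.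
  by rewrite /= -innerxx -adjointP.
have := cauchy_schwarz (A x) x; rewrite E rnorm_real; last first.
  by apply: sumr_ge0 => i _; exact: sqr_ge0.
move/le_trans; apply; rewrite expr2 mulrA ler_wpM2r ?rnorm_ge0//.
exact: ler_opnorm.
Qed.

(** The square of |A x| is the sum of the inner products of F_i^* x and F_i^* y, where y = A x. The
    weights in the arithmetic-geometric inequality are chosen so that each half becomes s |x| |y| /
    2. Together with [column_le_rnorm], this makes [rnorm A] the best constant. *)
Lemma rnorm_row_le (s : R) : 0 <= s ->
  (forall x, \sum_(i : I) rnorm (adjoint (F i) x) ^+ 2 <= s * rnorm x ^+ 2) ->
  rnorm A <= s.
Proof.
move=> s0 Fs; apply: opnorm_le => // x; set y := A x.
have [y0|y0] := eqVneq y 0; first by rewrite y0 rnorm0 mulr_ge0 ?rnorm_ge0.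
have [x0|x0] := eqVneq x 0; first by rewrite /y x0 linear0 !rnorm0 mulr0.
have yp : 0 < rnorm y by rewrite rnorm_gt0.
have xp : 0 < rnorm x by rewrite rnorm_gt0.
rewrite -(ler_pM2r yp) -expr2.
have -> : rnorm y ^+ 2 =
    rnorm (\sum_(i : I) inner (adjoint (F i) x) (adjoint (F i) y)).
  rewrite -[LHS](@rnorm_real R) ?sqr_ge0// -innerxx {1}/y bop_sumE inner_suml.
  by congr rnorm; apply: eq_bigr => i _; rewrite /= adjointP.
rewrite (le_trans (rnorm_sum _ _ _))//.
apply: (@le_trans _ _ (\sum_(i : I) (rnorm y / (2 * rnorm x) * rnorm (adjoint (F i) x) ^+ 2 +
    rnorm x / (2 * rnorm y) * rnorm (adjoint (F i) y) ^+ 2))).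
  apply: ler_sum => i _; rewrite (le_trans (cauchy_schwarz _ _))//.
  set p := rnorm (adjoint _ _); set q := rnorm (adjoint _ _).
  rewrite -subr_ge0; have -> : rnorm y / (2 * rnorm x) * p ^+ 2 +
      rnorm x / (2 * rnorm y) * q ^+ 2 - p * q =
    (2 * rnorm x * rnorm y)^-1 * (rnorm y * p - rnorm x * q) ^+ 2.
    by field; rewrite !gt_eqF.
  by rewrite mulr_ge0 ?sqr_ge0// invr_ge0 !mulr_ge0// ltW.
rewrite big_split /= -!mulr_sumr.
have -> : s * rnorm x * rnorm y =
    rnorm y / (2 * rnorm x) * (s * rnorm x ^+ 2) +
    rnorm x / (2 * rnorm y) * (s * rnorm y ^+ 2).
  by field; rewrite !gt_eqF.
by rewrite lerD// ler_wpM2l ?Fs// divr_ge0 ?mulr_ge0 ?rnorm_ge0.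
Qed.

End rows.

(** * Norm axioms, conjugation and continuity *)

Section radius_properties.
Context {R : realType} {n : nat}.
Local Notation C := R[i].
Implicit Types H K : hilbertType R.

Local Notation word := (seq 'I_n).
Local Notation w := (@joint_numerical_radius R _ n).

Definition row_norm H (T : 'I_n -> {bop H -> H}) : R :=
  Num.sqrt (rnorm (\sum_(i < n) T i \oB adjoint (T i))).

Lemma row_norm_form_bounded H (T : 'I_n -> {bop H -> H}) :
  form_bounded T (row_norm T).
Proof.
apply: column_form_bounded => [|x]; first exact: sqrtr_ge0.
by rewrite sqr_sqrtr ?rnorm_ge0// column_le_rnorm.
Qed.

Lemma has_sup_values H (T : 'I_n -> {bop H -> H}) :
  has_sup (joint_numerical_values T).
Proof.
exact: (form_bounded_has_sup (sqrtr_ge0 _) (@row_norm_form_bounded _ T)).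
Qed.

Lemma radius_ge0 H (T : 'I_n -> {bop H -> H}) : 0 <= w T.
Proof.
have [v Tv] := values_nonempty T.
apply: (@le_trans _ _ v); first by case: Tv => h _ <-; exact: rnorm_ge0.
by apply: ub_le_sup => //; case: (has_sup_values T).
Qed.

Lemma radius_form_bounded H (T : 'I_n -> {bop H -> H}) : form_bounded T (w T).
Proof. exact: form_bounded_radius (has_sup_values T). Qed.

Lemma radius_le_row_norm H (T : 'I_n -> {bop H -> H}) : w T <= row_norm T.
Proof. exact: radius_le (sqrtr_ge0 _) (@row_norm_form_bounded _ T). Qed.

Lemma radius_column_le H (T : 'I_n -> {bop H -> H}) x :
  \sum_(j < n) rnorm (adjoint (T j) x) ^+ 2 <= (2 * w T) ^+ 2 * rnorm x ^+ 2.
Proof. exact: radius_column_bounded (radius_ge0 T) (@radius_form_bounded _ T) x. Qed.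

Lemma row_norm_le_radius H (T : 'I_n -> {bop H -> H}) : 2^-1 * row_norm T <= w T.
Proof.
rewrite ler_pdivrMl// -[leRHS]ger0_norm ?mulr_ge0 ?radius_ge0// -sqrtr_sqr.
by rewrite ler_wsqrtr// rnorm_row_le ?sqr_ge0// => x; exact: radius_column_le.
Qed.

Lemma radius0 H : w (fun=> 0 : {bop H -> H}) = 0.
Proof.
apply/le_anti; rewrite radius_ge0 andbT; apply: radius_le => // h N.
rewrite mul0r /form_upto big1 ?rnorm0// => a _; apply: big1 => j _.
by rewrite -[X in inner _ X]/(0 : H) inner0r.
Qed.

Lemma adjoint0 K H : adjoint (0 : {bop K -> H}) = 0.
Proof.
apply/bopP => x; apply: inner_inj => z; rewrite -adjointP.
by rewrite -[X in inner X _]/(0 : H) -[X in _ = inner _ X]/(0 : K) inner0l inner0r.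
Qed.

(** By [radius_column_le], a zero radius kills every [adjoint (T j)], hence every [T j]. *)
Lemma radius_eq0 H (T : 'I_n -> {bop H -> H}) : w T = 0 <-> forall j, T j = 0.
Proof.
split=> [w0 j|T0]; last first.
  by rewrite (_ : T = fun=> 0) ?radius0//; apply/funext.
rewrite -[T j]adjointK; suff -> : adjoint (T j) = 0 by exact: adjoint0.
apply/bopP => x; rewrite -[RHS]/(0 : H); apply/eqP; rewrite -rnorm_eq0 -sqrf_eq0.
have := radius_column_le T x; rewrite w0 mulr0 expr0n mul0r => le0.
rewrite eq_le sqr_ge0 andbT (le_trans _ le0)// (bigD1 j)//= lerDl.
by apply: sumr_ge0 => i _; exact: sqr_ge0.
Qed.

Lemma radiusZ_le H (T : 'I_n -> {bop H -> H}) (l : C) :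
  w (fun j => l *: T j) <= rnorm l * w T.
Proof.
apply: radius_le => [|h N]; first by rewrite mulr_ge0 ?rnorm_ge0 ?radius_ge0.
have -> : form_upto (fun j => l *: T j) h N = l^* * form_upto T h N.
  rewrite /form_upto mulr_sumr; apply: eq_bigr => a _; rewrite mulr_sumr.
  by apply: eq_bigr => j _; rewrite -innerZr.
by rewrite rnormM rnorm_conj -mulrA ler_wpM2l ?rnorm_ge0 ?radius_form_bounded.
Qed.

Lemma radiusZ H (T : 'I_n -> {bop H -> H}) (l : C) :
  w (fun j => l *: T j) = rnorm l * w T.
Proof.
have [->|l0] := eqVneq l 0.
  have -> : (fun j => 0 *: T j) = fun=> 0 by apply/funext => j; rewrite scale0r.
  by rewrite radius0 rnorm0 mul0r.
have lp : 0 < rnorm l by rewrite rnorm_gt0.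
apply/le_anti; rewrite radiusZ_le /= -ler_pdivlMl//.
have {1}-> : T = fun j => l^-1 *: (l *: T j).
  by apply/funext => j; rewrite scalerA mulVf// scale1r.
rewrite (le_trans (radiusZ_le _ _))//.
suff -> : rnorm l^-1 = (rnorm l)^-1 by [].
by apply: (mulfI (lt0r_neq0 lp)); rewrite -rnormM mulfV// mulfV ?gt_eqF// /rnorm normr1.
Qed.

Lemma radiusD H (T T' : 'I_n -> {bop H -> H}) :
  w (fun j => T j + T' j) <= w T + w T'.
Proof.
apply: radius_le => [|h N]; first by rewrite addr_ge0 ?radius_ge0.
have -> : form_upto (fun j => T j + T' j) h N = form_upto T h N + form_upto T' h N.
  rewrite /form_upto -big_split; apply: eq_bigr => a _ /=; rewrite -big_split /=.
  by apply: eq_bigr => j _; rewrite -innerDr.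
by rewrite (le_trans (ler_rnormD _ _))// mulrDl lerD ?radius_form_bounded.
Qed.

(** By [adjointP], the form of the conjugated tuple at [h] is the form of [T] at [X \o h], whose
    mass is larger by at most the factor [rnorm X ^+ 2]. *)
Lemma radius_conj_le H K (T : 'I_n -> {bop H -> H}) (X : {bop K -> H}) :
  w (fun j => adjoint X \oB T j \oB X) <= rnorm X ^+ 2 * w T.
Proof.
apply: radius_le => [|h N]; first by rewrite mulr_ge0 ?sqr_ge0 ?radius_ge0.
have -> : form_upto (fun j => adjoint X \oB T j \oB X) h N = form_upto T (X \o h) N.
  by apply: eq_bigr => a _; apply: eq_bigr => j _; rewrite /= -adjointP.
rewrite (le_trans (radius_form_bounded _ _ _))// [_ ^+ 2 * _]mulrC -mulrA ler_wpM2l ?radius_ge0//.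
rewrite /mass_upto mulr_sumr; apply: ler_sum => a _ /=.
by rewrite -exprMn ler_sqr ?nnegrE ?mulr_ge0 ?rnorm_ge0 ?ler_opnorm.
Qed.

Lemma isometry_rnorm H K (U : {bop K -> H}) : adjoint U \oB U = bop_id K ->
  rnorm U <= 1.
Proof.
move=> UU; apply: opnorm_le => // x; rewrite mul1r.
rewrite -ler_sqr ?nnegrE ?rnorm_ge0// -lecR -!innerxx adjointP.
by rewrite -[X in inner x X]/((adjoint U \oB U) x) UU.
Qed.

Lemma radius_unitary H K (T : 'I_n -> {bop H -> H}) (U : {bop K -> H}) :
  unitary U -> w (fun j => adjoint U \oB T j \oB U) = w T.
Proof.
move=> [UU UU']; apply/le_anti/andP; split.
  rewrite (le_trans (radius_conj_le _ _))// ler_piMl ?radius_ge0//.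
  by rewrite expr_le1 ?rnorm_ge0// isometry_rnorm.
(* [T] is in turn the conjugate of the new tuple by [adjoint U], which is an isometry as well. *)
have {1}-> : T = fun j => adjoint (adjoint U) \oB (adjoint U \oB T j \oB U) \oB adjoint U.
  apply/funext => j; apply/bopP => x; rewrite adjointK /=.
  have UUx y : U (adjoint U y) = y by rewrite -[LHS]/((U \oB adjoint U) y) UU'.
  by rewrite !UUx.
rewrite (le_trans (radius_conj_le _ _))// ler_piMl ?radius_ge0//.
by rewrite expr_le1 ?rnorm_ge0// isometry_rnorm// adjointK.
Qed.

(** A crude bound, in the form that continuity needs: a sum of squares of norms is at most the
    square of their sum. *)
Lemma radius_le_sum H (T : 'I_n -> {bop H -> H}) : w T <= \sum_(j < n) rnorm (T j).
Proof.
have s0 : 0 <= \sum_(j < n) rnorm (T j) by apply: sumr_ge0 => j _; exact: rnorm_ge0.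
apply: radius_le => //; apply: column_form_bounded => // x.
rewrite expr2 mulr_suml mulr_suml; apply: ler_sum => j _.
apply: (@le_trans _ _ (rnorm (T j) ^+ 2 * rnorm x ^+ 2)).
  rewrite -exprMn ler_sqr ?nnegrE ?mulr_ge0 ?rnorm_ge0//.
  rewrite (le_trans (ler_opnorm _ _))// ler_wpM2r ?rnorm_ge0//.
  exact: rnorm_adjoint.
rewrite ler_wpM2r ?sqr_ge0// expr2 ler_wpM2l ?rnorm_ge0//.
by rewrite (bigD1 j)//= lerDl; apply: sumr_ge0 => i _; exact: rnorm_ge0.
Qed.

Lemma radius_dist H (T T' : 'I_n -> {bop H -> H}) :
  `|w T - w T'| <= \sum_(j < n) rnorm (T j - T' j).
Proof.
have le12 (S S' : 'I_n -> {bop H -> H}) :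
    w S <= w S' + \sum_(j < n) rnorm (S j - S' j).
  have {1}-> : S = fun j => S' j + (S j - S' j).
    by apply/funext => j; rewrite addrC subrK.
  by rewrite (le_trans (radiusD _ _))// lerD2l radius_le_sum.
rewrite ler_norml lerBlDl le12 andbT lerNl opprB lerBlDl.
by under eq_bigr do rewrite rnorm_distC; exact: le12.
Qed.

(** Over the finite index set ['I_n], the topology of pointwise convergence is the norm topology on
    tuples. *)
Lemma radius_continuous H :
  continuous (fun T : {ptws 'I_n -> {bop H -> H}} => w (T : 'I_n -> {bop H -> H})).
Proof.
move=> T.
suff h (e : R) : 0 < e -> \forall T' \near T, `|w T - w T'| <= e.
  apply: (proj2 (@cvgrPdist_le R R _ (nbhs T) _ (fun T' => w T') (w T))) => e; exact: h.
move=> e0.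
(* [n.+1] rather than [n] keeps the quotient positive when [n = 0]. *)
have d0 : 0 < (e / n.+1%:R)%:C%C :> C by rewrite ltcR divr_gt0.
have near_j (j : 'I_n) : \forall T' \near T, rnorm (T j - T' j) <= e / n.+1%:R.
  have := @proj_continuous 'I_n (fun=> {bop H -> H}) j T.
  move/(proj1 (@cvgrPdist_le _ _ _ (nbhs T) _ _ _))/(_ _ d0).
  by apply: filterS => T'; rewrite rnormE lecR.
have := filter_forall (nbhs_filter T) near_j.
apply: filterS => T' h; rewrite (le_trans (radius_dist _ _))//.
apply: (@le_trans _ _ (\sum_(j < n) e / n.+1%:R)); first by apply: ler_sum => j _.
rewrite sumr_const card_ord -[X in X <= _]mulr_natr -mulrA ler_piMr ?(ltW e0)//.
by rewrite mulrC ler_pdivrMr// mul1r ler_nat.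
Qed.

End radius_properties.

(** * Joint spectral radius *)

Section fekete.
Context {R : realType}.

Lemma powR_root (x : R) k : 0 <= x -> (x ^+ k.+1) `^ k.+1%:R^-1 = x.
Proof.
by move=> x0; rewrite -powR_mulrn// -powRrM mulfV ?pnatr_eq0// powRr1.
Qed.

Lemma powR_rootX (x : R) k : 0 <= x -> (x `^ k.+1%:R^-1) ^+ k.+1 = x.
Proof.
by move=> x0; rewrite -powR_mulrn ?powR_ge0// -powRrM mulVf ?pnatr_eq0// powRr1.
Qed.

Lemma powR_root_le (x y : R) k : 0 <= x -> 0 <= y -> x <= y ^+ k.+1 ->
  x `^ k.+1%:R^-1 <= y.
Proof.
move=> x0 y0 xy; rewrite -[leRHS](powR_root k y0).
by apply: ge0_ler_powR; rewrite ?nnegrE ?exprn_ge0// invr_ge0.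
Qed.

(** The limit is the infimum of the roots over k >= 1. The argument stays multiplicative because [v]
    may vanish and then has no logarithm. *)
Lemma fekete_submultiplicative (v : nat -> R) : (forall k, 0 <= v k) ->
  (forall k l, v (k + l)%N <= v k * v l) -> cvgn (fun k => v k `^ k%:R^-1).
Proof.
move=> v0 vM; pose a k := v k `^ k%:R^-1.
pose A := [set a k.+1 | k in [set: nat]].
have A0 : has_inf A.
  by split; [exists (a 1%N), 0%N|exists 0 => _ [k _ <-]; exact: powR_ge0].
have infA k : inf A <= a k.+1 by apply: ge_inf; [case: A0|exists k].
have inf0 : 0 <= inf A by apply: lb_le_inf; [case: A0|move=> _ [k _ <-]; exact: powR_ge0].
apply/cvg_ex; exists (inf A).
apply: (proj2 (@cvgrPdist_le R R _ \oo _ _ _)) => e e0.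
have e20 : 0 < e / 2 by rewrite divr_gt0.
have [_ [m _ <-] ab] := inf_adherent e20 A0.
set b := inf A + e / 2 in ab.
have b0 : 0 < b by rewrite /b; lra.
have vm : v m.+1 <= b ^+ m.+1.
  rewrite -(powR_rootX m (v0 m.+1)); apply: lerXn2r; rewrite ?nnegrE ?powR_ge0 ?ltW//.
(* Each full block of length [m.+1] costs a factor [b ^+ m.+1]. *)
have vq q r : v (q * m.+1 + r)%N <= (b ^+ m.+1) ^+ q * v r.
  elim: q => [|q IH]; first by rewrite mul0n add0n mul1r.
  rewrite mulSn -addnA (le_trans (vM _ _))// exprS -mulrA ler_pM//.
(* [K] dominates the contribution of every remainder [r] below [m.+1], whence
   [v k <= K * b ^+ k]. *)
pose K := 1 + \sum_(r < m.+1) v r / b ^+ r.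
have K0 : 0 < K.
  by rewrite ltr_wpDr// sumr_ge0// => r _; rewrite divr_ge0 ?exprn_ge0 ?v0 ?(ltW b0).
have vK k : v k <= K * b ^+ k.
  rewrite {1 2}(divn_eq k m.+1) (le_trans (vq _ _))// exprD mulnC exprM mulrCA.
  rewrite ler_wpM2l ?exprn_ge0 ?(ltW b0)//.
  rewrite -ler_pdivrMr ?exprn_gt0//.
  have km : (k %% m.+1 < m.+1)%N by rewrite ltn_mod.
  rewrite /K (bigD1 (Ordinal km))//= addrCA lerDl addr_ge0// sumr_ge0// => r _.
  by rewrite divr_ge0 ?exprn_ge0 ?v0 ?(ltW b0).
(* Past this index Bernoulli's inequality absorbs the constant: K is at most (1 + e / (2b))^k, and b
   (1 + e / (2b)) is [inf A + e]. *)
exists (Num.truncn (K / (e / 2 / b))).+1 => // -[//|k] /= hk.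
rewrite distrC ger0_norm ?subr_ge0 ?infA// lerBlDl.
have be : inf A + e = b * (1 + e / 2 / b) 
  by rewrite mulrDr mulr1 [b * _]mulrC divfK ?gt_eqF// /b -addrA -splitr.
have c0 : 0 < e / 2 / b by rewrite divr_gt0.
rewrite be; apply: powR_root_le => //; first by rewrite mulr_ge0 ?(ltW b0)// addr_ge0// ltW.
rewrite (le_trans (vK _))// exprMn mulrC ler_wpM2l ?exprn_ge0 ?(ltW b0)//.
have bern j : 1 + j%:R * (e / 2 / b) <= (1 + e / 2 / b) ^+ j.
  elim: j => [|j IH]; first by rewrite mul0r addr0.
  rewrite exprS (le_trans _ (ler_wpM2l _ IH)) ?addr_ge0 ?(ltW c0)//.
  rewrite -natr1; set t := j%:R; have t0 : 0 <= t by exact: ler0n.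
  by have := sqr_ge0 (e / 2 / b); nra.
rewrite (le_trans _ (bern _))// (le_trans _ (ler_wpDl _ (lexx _)))//.
rewrite -ler_pdivrMr// ltW// (lt_le_trans (truncnS_gt _))// ler_nat.
exact: hk.
Qed.

Lemma telescope_ratio (f : nat -> R) N : (forall k, (k <= N)%N -> f k != 0) ->
  \prod_(k < N) (f k.+1 / f k) = f N / f 0%N.
Proof.
elim: N => [|N IH] f0; first by rewrite big_ord0 divff ?f0.
rewrite big_ord_recr /= IH => [|k kN]; last by rewrite f0// ltnW.
by rewrite mulrC mulrA divfK ?f0.
Qed.

End fekete.

(** * Comparison of the spectral and numerical radii *)

Section spectral_radius.
Context {R : realType} {n : nat}.
Local Notation C := R[i].
Local Notation word := (seq 'I_n).
Variables (H : hilbertType R) (T : 'I_n -> {bop H -> H}).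
Local Notation w := (joint_numerical_radius T).

Lemma big_levelD (V : nmodType) (F : word -> V) k l :
  \sum_(a <- level n (k + l)) F a =
  \sum_(b <- level n k) \sum_(c <- level n l) F (b ++ c).
Proof.
elim: k F => [|k IH] F.
  by rewrite add0n big_level0.
rewrite addSn !big_levelS IH; apply: eq_bigr => b _; exact: exchange_big.
Qed.

Lemma big_level_rev (V : nmodType) (F : word -> V) k :
  \sum_(a <- level n k) F (rev a) = \sum_(a <- level n k) F a.
Proof.
rewrite -(big_map rev predT F); apply: perm_big; apply: uniq_perm.
- by rewrite map_inj_uniq ?level_uniq//; exact: (can_inj revK).
- exact: level_uniq.
- move=> a; rewrite -[a in LHS]revK mem_map ?mem_level ?size_rev//.
  exact: (can_inj revK).
Qed.

Lemma word_op_cat (a b : word) : word_op T (a ++ b) = word_op T a \oB word_op T b.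
Proof. by elim: a => [|j a IH]; apply/bopP => x //=; rewrite IH. Qed.

Definition level_norm k : R :=
  rnorm (\sum_(a : k.-tuple 'I_n) word_op T a \oB adjoint (word_op T a)).

Definition level_mass k (x : H) : R :=
  \sum_(a <- level n k) rnorm (adjoint (word_op T a) x) ^+ 2.

Lemma level_mass_ge0 k x : 0 <= level_mass k x.
Proof. by apply: sumr_ge0 => a _; exact: sqr_ge0. Qed.

Lemma level_mass_le k x : level_mass k x <= level_norm k * rnorm x ^+ 2.
Proof. by rewrite /level_mass big_level_tuple column_le_rnorm. Qed.

Lemma level_norm_le k (s : R) : 0 <= s ->
  (forall x, level_mass k x <= s * rnorm x ^+ 2) -> level_norm k <= s.
Proof.
move=> s0 h; apply: rnorm_row_le => // x.
by rewrite -(big_level_tuple (fun a => rnorm (adjoint (word_op T a) x) ^+ 2)) h.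
Qed.

(** Since T_{bc}^* = T_c^* T_b^*, the bound for level [l] applies at each vector T_b^* x, and the
    bound for level [k] sums these up. *)
Lemma level_normD k l : level_norm (k + l) <= level_norm k * level_norm l.
Proof.
apply: level_norm_le => [|x]; first by rewrite mulr_ge0 ?rnorm_ge0.
rewrite /level_mass big_levelD.
apply: (@le_trans _ _ (\sum_(b <- level n k)
    level_norm l * rnorm (adjoint (word_op T b) x) ^+ 2)).
  apply: ler_sum => b _; rewrite (le_trans _ (level_mass_le _ _))//.
  by apply: ler_sum => c _; rewrite word_op_cat adjoint_comp.
by rewrite -mulr_sumr [level_norm k * _]mulrC -mulrA ler_wpM2l ?rnorm_ge0 ?level_mass_le.
Qed.

Lemma joint_spectral_seq_cvg : cvgn (joint_spectral_seq T).
Proof.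
(* The exponent 1 / (2k) is split so that the submultiplicative sequence is the square root of
   [level_norm]. *)
have -> : joint_spectral_seq T = fun k => (level_norm k `^ 2^-1) `^ k%:R^-1.
  by apply/funext => k; rewrite -powRrM -invfM.
apply: fekete_submultiplicative => [k|k l]; first exact: powR_ge0.
rewrite -powRM ?rnorm_ge0//; apply: ge0_ler_powR; rewrite ?nnegrE ?invr_ge0//.
- exact: rnorm_ge0.
- by rewrite mulr_ge0 ?rnorm_ge0.
- exact: level_normD.
Qed.

(** The adjoints act in the order opposite to [adjoint (word_op T a)], so that prepending [j]
    applies [adjoint (T j)] last, as the pairing in the form requires. *)
Definition adjoint_orbit (x : H) (a : word) : H :=
  foldr (fun j y => adjoint (T j) y) x a.

Lemma adjoint_orbitE x a : adjoint_orbit x a = adjoint (word_op T (rev a)) x.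
Proof.
elim: a => [|j a IH]; first by rewrite /= adjoint_id.
rewrite rev_cons -cats1 word_op_cat adjoint_comp /= IH.
by congr (adjoint _ _); apply/bopP.
Qed.

(** Reversal permutes the words of each level, so both orders give the same mass. *)
Lemma level_mass_orbit k x :
  level_mass k x = \sum_(a <- level n k) rnorm (adjoint_orbit x a) ^+ 2.
Proof.
by rewrite /level_mass -big_level_rev; apply: eq_bigr => a _; rewrite adjoint_orbitE.
Qed.

Lemma level_mass0 x : level_mass 0 x = rnorm x ^+ 2.
Proof.
by rewrite level_mass_orbit big_level0.
Qed.

Lemma level_massS k x :
  level_mass k.+1 x =
  \sum_(a <- level n k) \sum_(j < n) rnorm (adjoint (T j) (adjoint_orbit x a)) ^+ 2.
Proof. by rewrite level_mass_orbit big_levelS. Qed.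

(** The column bound at each orbit vector carries a vanishing mass from one level to the next. *)
Lemma level_mass_eq0 k l x : (k <= l)%N -> level_mass k x = 0 -> level_mass l x = 0.
Proof.
move=> /subnKC <-; elim: (l - k)%N => [|d IH] k0; first by rewrite addn0.
apply/le_anti; rewrite level_mass_ge0 andbT addnS level_massS.
apply: (@le_trans _ _ (\sum_(a <- level n (k + d))
   rnorm (\sum_(i < n) T i \oB adjoint (T i)) * rnorm (adjoint_orbit x a) ^+ 2)).
  by apply: ler_sum => a _; exact: column_le_rnorm.
by rewrite -mulr_sumr -level_mass_orbit IH// mulr0.
Qed.

(* Weighting the orbit [adjoint_orbit x] by a function of the length of words
   turns the form into that of a weighted shift. *)
Lemma weighted_orbit_le (c : nat -> R) N x : (forall k, 0 <= c k) ->
  \sum_(k < N) c k * c k.+1 * level_mass k.+1 x <=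
  w * \sum_(k < N.+1) c k ^+ 2 * level_mass k x.
Proof.
move=> c0; pose h (a : word) := (c (size a))%:C%C *: adjoint_orbit x a.
have conj_real (t : R) : (t%:C%C : C)^* = t%:C%C by rewrite conj_Creal// complex_real.
have := radius_form_bounded T h N.
have -> : mass_upto h N.+1 = \sum_(k < N.+1) c k ^+ 2 * level_mass k x.
  rewrite /mass_upto big_words_level; apply: eq_bigr => k _.
  rewrite level_mass_orbit mulr_sumr; apply: eq_big_seq => a.
  by rewrite mem_level => /eqP ak; rewrite /h rnormZ exprMn rnorm_real ak.
have -> : form_upto T h N = (\sum_(k < N) c k * c k.+1 * level_mass k.+1 x)%:C%C.
  rewrite /form_upto big_words_level rmorph_sum; apply: eq_bigr => k _ /=.
  rewrite level_massS mulr_sumr rmorph_sum; apply: eq_big_seq => a.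
  rewrite mem_level => /eqP ak; rewrite /= mulr_sumr rmorph_sum; apply: eq_bigr => j _.
  rewrite /h /= ak linearZ innerZl innerZr mulrA conj_real adjointPr innerxx.
  by rewrite -!rmorphM.
rewrite rnorm_real// sumr_ge0// => k _; by rewrite !mulr_ge0 ?level_mass_ge0.
Qed.

Lemma level_mass_le_radius N x :
  level_mass N.+1 x <= ((w * (N.+2%:R / N.+1%:R)) ^+ N.+1) ^+ 2 * rnorm x ^+ 2.
Proof.
have b0 : 0 <= w * (N.+2%:R / N.+1%:R) by rewrite mulr_ge0 ?radius_ge0.
(* A nonzero last mass makes all earlier masses nonzero, so that one may divide by every [f k]. *)
have [->|sN] := eqVneq (level_mass N.+1 x) 0.
  by rewrite mulr_ge0 ?sqr_ge0.
pose f k := Num.sqrt (level_mass k x).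
have f_gt0 k : (k <= N.+1)%N -> 0 < f k.
  move=> kN; rewrite sqrtr_gt0 lt_def level_mass_ge0 andbT.
  by apply: contraNneq sN => k0; rewrite (level_mass_eq0 kN k0).
have fsq k : f k ^+ 2 = level_mass k x by rewrite sqr_sqrtr ?level_mass_ge0.
(* With the weights [(f k)^-1], the terms on the left become the ratios and the [N.+2] terms on the
   right become 1. *)
have sum_le : \sum_(k < N.+1) f k.+1 / f k <= w * N.+2%:R.
  have := @weighted_orbit_le (fun k => (f k)^-1) N.+1 x _.
  move=> /(_ (fun k => _)); rewrite (eq_bigr (fun k : 'I_N.+1 => f k.+1 / f k)); last first.
    move=> k _; rewrite -fsq; field.
    by rewrite !gt_eqF ?f_gt0// ltnW// ltnS.
  rewrite [X in w * X](eq_bigr (fun=> 1)); last first.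
    by move=> k _; rewrite -fsq -exprMn mulVf ?expr1n// gt_eqF// f_gt0// -ltnS.
  by rewrite sumr_const card_ord; apply => k; rewrite invr_ge0 sqrtr_ge0.
have agm : \prod_(k < N.+1) (f k.+1 / f k) <=
    ((\sum_(k < N.+1) f k.+1 / f k) / N.+1%:R) ^+ N.+1.
  have := leif_AGM (A := [set: 'I_N.+1]%SET) (E := fun k : 'I_N.+1 => f k.+1 / f k).
  rewrite cardsT card_ord => /(_ (fun k _ => divr_ge0 (sqrtr_ge0 _) (sqrtr_ge0 _))).
  case=> h _; move: h; rewrite (eq_bigl xpredT) => [|k]; last by rewrite inE.
  by rewrite [in X in _ <= X -> _](eq_bigl xpredT) => [|k] //; rewrite inE.
(* The product of the ratios is f (N+1) / f 0, and f 0 is the norm of x. *)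
rewrite telescope_ratio in agm; last by move=> k kN; rewrite gt_eqF ?f_gt0.
rewrite ler_pdivrMr ?f_gt0// in agm.
rewrite -fsq -level_mass0 -fsq -exprMn ler_sqr ?nnegrE ?mulr_ge0 ?exprn_ge0 ?sqrtr_ge0//.
rewrite (le_trans agm)// ler_wpM2r ?sqrtr_ge0//.
apply: lerXn2r; rewrite ?nnegrE//.
  by rewrite divr_ge0// sumr_ge0// => k _; rewrite divr_ge0 ?sqrtr_ge0.
by rewrite mulrA ler_wpM2r ?invr_ge0.
Qed.

Lemma joint_spectral_seq_le N :
  joint_spectral_seq T N.+1 <= w * (N.+2%:R / N.+1%:R).
Proof.
have b0 : 0 <= w * (N.+2%:R / N.+1%:R) by rewrite mulr_ge0 ?radius_ge0.
(* The exponent 2 (N + 1) is written as a successor to fit [powR_root_le]. *)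
have -> : joint_spectral_seq T N.+1 = level_norm N.+1 `^ (N.*2.+1).+1%:R^-1.
  by rewrite /joint_spectral_seq -doubleS -mul2n natrM.
apply: powR_root_le => //; first exact: rnorm_ge0.
rewrite -doubleS -muln2 exprM; apply: level_norm_le => [|x]; first exact: sqr_ge0.
exact: level_mass_le_radius.
Qed.

Lemma joint_spectral_radius_le : joint_spectral_radius T <= w.
Proof.
apply/ler_addgt0Pr => e e0.
apply: limr_le; first exact: joint_spectral_seq_cvg.
(* From here on, w (k + 2) / (k + 1) = w + w / (k + 1) is at most [w + e]. *)
exists (Num.truncn (w / e)).+1 => // -[//|k] /= hk.
rewrite (le_trans (joint_spectral_seq_le k))//.
rewrite -natr1 mulrDl divff ?pnatr_eq0// mulrDr mulr1 lerD2l mul1r.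
rewrite ler_pdivrMr// mulrC -ler_pdivrMr// ltW// (lt_le_trans (truncnS_gt _))//.
by rewrite ler_nat.
Qed.

End spectral_radius.

(** * Tensor products *)

Section norm_convergence.
Context {R : realType}.
Local Notation C := R[i].

(** Convergence is measured by a real sequence, so that limit theorems in [R] serve vectors and
    complex scalars alike. *)
Definition rcvg (V : normedZmodType C) (u : nat -> V) (x : V) :=
  (rnorm (u m - x) @[m --> \oo] --> (0 : R)).

Lemma squeeze0 (f g : nat -> R) : (forall m, 0 <= f m <= g m) ->
  g @ \oo --> (0 : R) -> f @ \oo --> (0 : R).
Proof. by move=> fg; apply: squeeze_cvgr (cvg_cst 0); exact: nearW. Qed.

Lemma rcvgP (V : normedZmodType C) (u : nat -> V) x :
  rcvg u x <-> forall e : R, 0 < e -> exists N, forall m, (N <= m)%N -> rnorm (u m - x) < e.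
Proof.
split=> [ux e e0|h].
  have [N _ h] := proj1 (@cvgr0Pnorm_lt R R _ \oo _ _) ux e e0.
  by exists N => m Nm; have := h m Nm; rewrite ger0_norm ?rnorm_ge0.
apply: (proj2 (@cvgr0Pnorm_lt R R _ \oo _ _)) => e e0; have [N hN] := h e e0.
by exists N => // m /= Nm; rewrite ger0_norm ?rnorm_ge0 ?hN.
Qed.

Lemma rcvg_inv (V : normedZmodType C) (u : nat -> V) x :
  (forall m, rnorm (u m - x) <= m.+1%:R^-1) -> rcvg u x.
Proof.
move=> ux; apply: (@squeeze0 _ (fun m => m.+1%:R^-1)) => [m|].
  by rewrite rnorm_ge0 ux.
exact: cvg_harmonic.
Qed.

Lemma rcvg_cst (V : normedZmodType C) (x : V) : rcvg (fun=> x) x.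
Proof. by rewrite /rcvg subrr rnorm0; exact: cvg_cst. Qed.

Lemma rcvgD (V : normedZmodType C) (u v : nat -> V) x y :
  rcvg u x -> rcvg v y -> rcvg (fun m => u m + v m) (x + y).
Proof.
move=> ux vy; apply: (@squeeze0 _ (fun m => rnorm (u m - x) + rnorm (v m - y))).
  by move=> m; rewrite rnorm_ge0 opprD addrACA ler_rnormD.
by rewrite -(addr0 0); exact: cvgD.
Qed.

Lemma rcvg_sum (V : normedZmodType C) (I : Type) (s : seq I) (u : I -> nat -> V) x :
  (forall i, rcvg (u i) (x i)) ->
  rcvg (fun m => \sum_(i <- s) u i m) (\sum_(i <- s) x i).
Proof.
move=> ux; elim: s => [|i s IH].
  by under eq_fun do rewrite big_nil; rewrite big_nil; exact: rcvg_cst.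
by rewrite big_cons; under eq_fun do rewrite big_cons; exact: rcvgD.
Qed.

Lemma rcvgZ (V : normedModType C) (a : C) (u : nat -> V) x :
  rcvg u x -> rcvg (fun m => a *: u m) (a *: x).
Proof.
move=> ux; rewrite /rcvg; under eq_fun do rewrite -scalerBr rnormZ.
by rewrite -(mulr0 (rnorm a)); apply: cvgM => //; exact: cvg_cst.
Qed.

Lemma rcvg_rnorm (V : normedZmodType C) (u : nat -> V) x :
  rcvg u x -> rnorm (u m) @[m --> \oo] --> rnorm x.
Proof.
move=> /rcvgP ux; apply: (proj2 (@cvgrPdist_lt R R _ \oo _ _ _)) => e e0.
have [N uN] := ux e e0; exists N => // m /= Nm.
apply: le_lt_trans (uN m Nm); rewrite ler_norml lerNl opprB !lerBlDl; apply/andP; split.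
  by rewrite -{1}[u m](subrK x) addrC ler_rnormD.
by rewrite -{1}[x](subrK (u m)) addrC (le_trans (ler_rnormD _ _))// lerD2l rnorm_distC.
Qed.

Lemma rcvg_bop (K H : normedModType C) (S : {bop K -> H}) (u : nat -> K) x :
  rcvg u x -> rcvg (fun m => S (u m)) (S x).
Proof.
move=> ux; apply: (@squeeze0 _ (fun m => opnorm S * rnorm (u m - x))).
  by move=> m; rewrite rnorm_ge0 -linearB ler_opnorm.
by rewrite -(mulr0 (opnorm S)); apply: cvgM => //; exact: cvg_cst.
Qed.

Lemma rcvg_inner (H : hilbertType R) (u v : nat -> H) x y :
  rcvg u x -> rcvg v y -> rcvg (fun m => inner (u m) (v m)) (inner x y).
Proof.
move=> ux vy; apply: (@squeeze0 _ (fun m => rnorm (u m - x) * rnorm (v m) +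
    rnorm x * rnorm (v m - y))).
  move=> m; rewrite rnorm_ge0 /=.
  have -> : inner (u m) (v m) - inner x y =
      inner (u m - x) (v m) + inner x (v m - y) :> C.
    by rewrite innerDl innerNl innerDr innerNr addrA subrK.
  by rewrite (le_trans (ler_rnormD _ _))// lerD ?cauchy_schwarz.
have -> : 0 = 0 * rnorm y + rnorm x * 0 :> R by rewrite mul0r mulr0 addr0.
by apply: cvgD; apply: cvgM => //; [exact: rcvg_rnorm|exact: cvg_cst].
Qed.

Lemma le_rcvg (f g : nat -> R) a b : f @ \oo --> a -> g @ \oo --> b ->
  (forall m, f m <= g m) -> a <= b.
Proof. by move=> fa gb fg; apply: (ler_cvg_to fa gb); exact: nearW. Qed.

(** The operator is given as a relation because a sum of simple tensors has many representations;
    the bound makes the relation single-valued. Its closure [cl] is the graph of [S]. *)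
Lemma dense_extension (V : normedModType C) (W : completeNormedModType C)
    (graph : V -> W -> Prop) (M : R) : 0 <= M ->
  (forall a x x' y y', graph x x' -> graph y y' ->
     graph (a *: x + y) (a *: x' + y')) ->
  (forall x x', graph x x' -> rnorm x' <= M * rnorm x) ->
  (forall x (e : R), 0 < e -> exists y y', graph y y' /\ rnorm (y - x) <= e) ->
  exists S : {bop V -> W}, forall x x', graph x x' -> S x = x'.
Proof.
move=> M0 grP grM grD.
pose cl x l := exists u u', [/\ forall m : nat, graph (u m) (u' m), rcvg u x & rcvg u' l].
have clP a x l y l' : cl x l -> cl y l' -> cl (a *: x + y) (a *: l + l').
  move=> [u [u' [h1 h2 h3]]] [v [v' [k1 k2 k3]]].
  exists (fun m => a *: u m + v m), (fun m => a *: u' m + v' m); split=> [m||].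
  - exact: grP.
  - by apply: rcvgD => //; exact: rcvgZ.
  - by apply: rcvgD => //; exact: rcvgZ.
have clM x l : cl x l -> rnorm l <= M * rnorm x.
  move=> [u [u' [h1 h2 h3]]]; apply: (le_rcvg (rcvg_rnorm h3) (g := fun m => M * rnorm (u m))).
    by apply: cvgM; [exact: cvg_cst|exact: rcvg_rnorm].
  by move=> m; exact: grM.
(* The difference of two limits is a limit at 0, where the bound [clM] kills it. *)
have clE x l l' : cl x l -> cl x l' -> l = l'.
  move=> h h'; apply/eqP; rewrite -subr_eq0 -rnorm_eq0 eq_le rnorm_ge0 andbT.
  have := clM _ _ (clP (-1) _ _ _ _ h' h).
  by rewrite !scaleN1r addNr rnorm0 mulr0 addrC.
have cl_ex x : exists l, cl x l.
  have /choice[p pP] (m : nat) : exists q : V * W, graph q.1 q.2 /\ rnorm (q.1 - x) <= m.+1%:R^-1.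
    have [|y [y' h]] := grD x m.+1%:R^-1; first by rewrite invr_gt0.
    by exists (y, y').
  pose u m := (p m).1; pose u' m := (p m).2.
  have ux : rcvg u x by apply: rcvg_inv => m; case: (pP m).
  have [|l lP] := @cauchy_rnorm_cvg _ W u'.
    (* [M + 1] keeps the denominator positive when [M = 0]. *)
    move=> e e0; have d0 : 0 < e / 2 / (M + 1) by rewrite !divr_gt0// ltr_wpDl.
    have [N hN] := proj1 (rcvgP u x) ux _ d0.
    exists N => i j Ni Nj.
    have h : graph (-1 *: u j + u i) (-1 *: u' j + u' i).
      by apply: grP; [case: (pP j)|case: (pP i)].
    have {h} := grM _ _ h; rewrite !scaleN1r ![- _ + _]addrC => h.
    apply: (le_lt_trans h).
    have h2 : rnorm (u i - u j) <= rnorm (u i - x) + rnorm (u j - x).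
      by rewrite (rnorm_distC (u j)) (le_trans _ (ler_rnormD _ _))// addrA subrK.
    have := hN _ Ni; have := hN _ Nj; rewrite !ltr_pdivlMr ?ltr_wpDl//.
    by have := rnorm_ge0 (u i - u j); nra.
  exists l, u, u'; split=> //; first by move=> m; case: (pP m).
  exact/rcvgP.
have [S SP] := choice cl_ex.
have Sb : S \in @bounded_op R V W.
  apply/bounded_opP; split=> [a x y|]; last by exists M => x; exact: clM.
  exact: (clE _ _ _ (SP _) (clP _ _ _ _ _ (SP x) (SP y))).
exists (Bop Sb) => x x' h; apply: (clE _ _ _ (SP x)).
by exists (fun=> x), (fun=> x'); split=> //; exact: rcvg_cst.
Qed.

End norm_convergence.

(** * Sums of simple tensors over orthonormal families *)

Section tensor.
Context {R : realType}.
Local Notation C := R[i].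

Definition orthonormal_seq (E : hilbertType R) (f : seq E) :=
  uniq f /\ {in f &, forall g g', inner g g' = (g == g')%:R :> C}.

Lemma orthonormal_seq_sum (E : hilbertType R) (f : seq E) (V : lmodType C)
    (F : E -> V) g : orthonormal_seq f -> g \in f ->
  \sum_(g' <- f) inner g' g *: F g' = F g.
Proof.
move=> [uf fo] gf; rewrite (bigD1_seq g)//= fo// eqxx scale1r big_seq_cond big1 ?addr0//.
by move=> g' /andP[g'f /negbTE g'g]; rewrite fo// g'g scale0r.
Qed.

(** The residual [r] of [e] is normalized and added to [f] unless it vanishes, so linearly dependent
    lists are allowed. *)
Lemma gram_schmidt (E : hilbertType R) (s : seq E) :
  exists2 f, orthonormal_seq f & {in s, forall e, e = \sum_(g <- f) inner e g *: g}.
Proof.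
elim: s => [|e s [f fo fs]]; first by exists [::].
pose p := \sum_(g <- f) inner e g *: g; pose r := e - p.
have rf g : g \in f -> inner r g = 0.
  move=> gf; rewrite /r innerDl innerNl /p inner_suml.
  rewrite (eq_bigr (fun g' => inner g' g *: (inner e g' : C^o))); last first.
    by move=> g' _; rewrite innerZl [RHS]mulrC.
  by rewrite (orthonormal_seq_sum (V := C^o) _ fo gf) subrr.
have [r0|r0] := eqVneq r 0.
  exists f => // x; rewrite inE => /predU1P[->|]; last exact: fs.
  by apply/eqP; rewrite -subr_eq0; apply/eqP.
have rp : 0 < rnorm r by rewrite rnorm_gt0.
have rn0 : (rnorm r)%:C%C != 0 :> C by rewrite -rnormE normr_eq0.
pose u := (rnorm r)^-1%:C%C *: r.
have rV : (rnorm r)^-1%:C%C = (rnorm r)%:C%C^-1 :> C by rewrite fmorphV.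
have uf g : g \in f -> inner u g = 0 by move=> gf; rewrite /u innerZl rf// mulr0.
have fu g : g \in f -> inner g u = 0 by move=> gf; rewrite innerC uf// conjC0.
have uu : inner u u = 1 :> C.
  rewrite innerxx /u rnormZ rnorm_real ?invr_ge0 ?rnorm_ge0// mulVf ?gt_eqF//.
  by rewrite expr1n.
have unf : u \notin f.
  by apply/negP => /uf; rewrite uu => /eqP; rewrite oner_eq0.
have [uqf f1] := fo.
exists (u :: f); first split=> /=; first by rewrite unf.
  move=> g g'; rewrite !inE => /predU1P[->|gf] /predU1P[->|g'f].
  - by rewrite eqxx.
  - by rewrite uf// (negbTE (memPnC unf _ g'f)).
  - by rewrite fu// (negbTE (memPn unf _ gf)).
  - exact: f1.
(* Combinations of [f] have no component along the new vector, so the earlier expansions keep their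
   form. *)
have comb_u (a : E -> C) : inner (\sum_(g <- f) a g *: g) u = 0.
  rewrite inner_suml big_seq big1// => g gf; by rewrite innerZl fu// mulr0.
move=> x; rewrite inE => /predU1P[->|xs]; rewrite big_cons; last first.
  by rewrite {2}(fs x xs) comb_u scale0r add0r; exact: fs.
rewrite -/p; apply/eqP; rewrite -subr_eq; apply/eqP; rewrite -/r.
have -> : inner e u = (rnorm r)%:C%C :> C.
  rewrite -[e](subrK p) innerDl comb_u addr0 -/r /u innerZr innerxx.
  rewrite conj_Creal ?complex_real// rmorphXn expr2 mulrA rV mulVf//.
  by rewrite mul1r.
by rewrite /u scalerA rV mulfV// scale1r.
Qed.

Variables (E H G : hilbertType R) (tau : {bilinear E -> H -> G}).
Hypothesis tauP : is_tensor_product tau.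

Lemma inner_tau e e' h h' : inner (tau e h) (tau e' h') = inner e e' * inner h h'.
Proof. by case: tauP. Qed.

Lemma tau_suml I (s : seq I) (F : I -> E) h :
  tau (\sum_(i <- s) F i) h = \sum_(i <- s) tau (F i) h.
Proof. by elim/big_rec2: _ => [|i x y _ <-]; rewrite ?linear0l ?linearDl. Qed.

Lemma tau_sumr I (s : seq I) (F : I -> H) e :
  tau e (\sum_(i <- s) F i) = \sum_(i <- s) tau e (F i).
Proof. by elim/big_rec2: _ => [|i x y _ <-]; rewrite ?linear0r ?linearDr. Qed.

Lemma tauZ a e h : tau (a *: e) h = tau e (a *: h).
Proof. by rewrite linearZl_LR linearZr_LR. Qed.

Definition tensor_sum (s : seq (E * H)) : G := \sum_(p <- s) tau p.1 p.2.

(** The tensor paired with [g] in its first factor: the coefficient of [g] when [g] belongs to an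
    orthonormal family spanning the first factors. *)
Definition tensor_coord (s : seq (E * H)) (g : E) : H :=
  \sum_(p <- s) inner p.1 g *: p.2.

Definition map_tensor (T : H -> H) (s : seq (E * H)) := [seq (p.1, T p.2) | p <- s].

Lemma tensor_coord_map (T : {bop H -> H}) s g :
  tensor_coord (map_tensor T s) g = T (tensor_coord s g).
Proof.
rewrite /tensor_coord /map_tensor big_map linear_sum.
by apply: eq_bigr => p _; rewrite linearZ.
Qed.

Lemma tensor_sum_coord f s :
  {in s, forall p, p.1 = \sum_(g <- f) inner p.1 g *: g} ->
  tensor_sum s = \sum_(g <- f) tau g (tensor_coord s g).
Proof.
move=> sf; under [RHS]eq_bigr do rewrite tau_sumr.
rewrite exchange_big; apply: eq_big_seq => p ps.
rewrite {1}(sf p ps) tau_suml; apply: eq_bigr => g _.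
by rewrite tauZ.
Qed.

Lemma inner_orthonormal_tau f (k k' : E -> H) : orthonormal_seq f ->
  inner (\sum_(g <- f) tau g (k g)) (\sum_(g <- f) tau g (k' g)) =
  \sum_(g <- f) inner (k g) (k' g) :> C.
Proof.
move=> fo; rewrite inner_sumr; apply: eq_big_seq => g gf.
rewrite inner_suml (eq_bigr (fun g' => inner g' g *: (inner (k g') (k' g) : C^o))).
  by rewrite (orthonormal_seq_sum (V := C^o) _ fo gf).
by move=> g' _; rewrite inner_tau.
Qed.

(** Over an orthonormal family the squared norm is the sum of those of the coordinates, and [T] acts
    on each coordinate. *)
Lemma rnorm_tensor_map (T : {bop H -> H}) s :
  rnorm (tensor_sum (map_tensor T s)) <= rnorm T * rnorm (tensor_sum s).
Proof.
have [f fo fs] := gram_schmidt [seq p.1 | p <- s].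
have sf : {in s, forall p, p.1 = \sum_(g <- f) inner p.1 g *: g}.
  by move=> p ps; apply: fs; exact: map_f.
have nf s' : {in s', forall p, p.1 = \sum_(g <- f) inner p.1 g *: g} ->
    rnorm (tensor_sum s') ^+ 2 = \sum_(g <- f) rnorm (tensor_coord s' g) ^+ 2.
  move=> s'f; apply: complexI; rewrite -innerxx (tensor_sum_coord s'f).
  rewrite inner_orthonormal_tau// rmorph_sum; apply: eq_bigr => g _ /=.
  by rewrite innerxx.
rewrite -ler_sqr ?nnegrE ?mulr_ge0 ?rnorm_ge0// exprMn !nf//; last first.
  by move=> _ /mapP[p ps ->]; exact: (sf p ps).
rewrite mulr_sumr; apply: ler_sum => g _; rewrite tensor_coord_map -exprMn.
by rewrite ler_sqr ?nnegrE ?mulr_ge0 ?rnorm_ge0 ?ler_opnorm.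
Qed.

Lemma tensor_sum_dense (x : G) (e : R) : 0 < e ->
  exists s, rnorm (tensor_sum s - x) < e.
Proof.
move=> e0; have [_ dG] := tauP; have e0' : 0 < e%:C%C :> C by rewrite ltcR.
have [] := dG (ball x e%:C%C)°; last first.
- move=> y [/interior_subset xy [s ys]]; exists s; rewrite /tensor_sum -ys rnorm_distC.
  by move: xy; rewrite -ball_normE /= rnormE ltcR.
- exact: open_interior.
- by exists x; apply: nbhs_singleton; apply: nbhs_interior; exact: nbhsx_ballx.
Qed.

(** As for [adjoint], existence is what has to be shown: [dense_extension] extends the action on
    sums of simple tensors. *)
Lemma tensor_opP (T : {bop H -> H}) e h :
  tensor_op tau (bop_id E) T (tau e h) = tau e (T h).
Proof.
rewrite /tensor_op; case: xgetP => [S _ /= ->//|noS]; exfalso.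
have [|a x x' y y' [s [-> ->]] [s' [-> ->]]|_ _ [s [-> ->]]|x e' e'0|S SP] :=
  @dense_extension R G G (fun x x' => exists s, x = tensor_sum s /\
    x' = tensor_sum (map_tensor T s)) (rnorm T).
- exact: rnorm_ge0.
(* a x + y is represented by scaling the first factors of [s] and appending [s']. *)
- exists ([seq (a *: p.1, p.2) | p <- s] ++ s'); split.
    rewrite /tensor_sum big_cat big_map scaler_sumr; congr (_ + _).
    by apply: eq_bigr => p _; rewrite linearZl_LR.
  rewrite /tensor_sum /map_tensor map_cat -map_comp big_cat !big_map scaler_sumr.
  congr (_ + _); by apply: eq_bigr => p _; rewrite /= linearZl_LR.
- exact: rnorm_tensor_map.
- have [s sx] := tensor_sum_dense x e'0.
  by exists (tensor_sum s), (tensor_sum (map_tensor T s)); split; [exists s|exact: ltW].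
apply: (noS S) => e' h'; apply: SP; exists [:: (e', h')].
by rewrite /tensor_sum !big_seq1.
Qed.

Lemma tensor_op_sum (T : {bop H -> H}) s :
  tensor_op tau (bop_id E) T (tensor_sum s) = tensor_sum (map_tensor T s).
Proof.
rewrite /tensor_sum /map_tensor big_map linear_sum.
by apply: eq_bigr => p _; rewrite /= tensor_opP.
Qed.

Context {n : nat}.
Variable T : 'I_n -> {bop H -> H}.
Local Notation word := (seq 'I_n).
Local Notation S := (fun j => tensor_op tau (bop_id E) (T j)).

Lemma form_tensor_sum (s : word -> seq (E * H)) N :
  rnorm (form_upto S (fun a => tensor_sum (s a)) N) <=
  joint_numerical_radius T * mass_upto (fun a => tensor_sum (s a)) N.+1.
Proof.
(* One family serves all words of length at most [N], so that inner products of tensors at different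
   words are diagonal too. *)
have [f fo fs] := gram_schmidt (flatten [seq [seq p.1 | p <- s a] | a <- words n N.+1]).
have sf a : (size a <= N)%N -> {in s a, forall p, p.1 = \sum_(g <- f) inner p.1 g *: g}.
  move=> aN p ps; apply: fs; apply/flatten_mapP; exists a.
    by rewrite mem_words ltnS.
  exact: map_f.
have sE a : (size a <= N)%N ->
    tensor_sum (s a) = \sum_(g <- f) tau g (tensor_coord (s a) g).
  by move=> aN; apply: tensor_sum_coord; exact: sf.
have -> : form_upto S (fun a => tensor_sum (s a)) N =
    \sum_(g <- f) form_upto T (fun a => tensor_coord (s a) g) N.
  rewrite /form_upto [RHS]exchange_big; apply: eq_big_seq => a; rewrite mem_words => aN.
  rewrite [RHS]exchange_big; apply: eq_bigr => j _ /=.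
  rewrite tensor_op_sum sE ?(ltnW aN)// (@tensor_sum_coord f); last first.
    by move=> _ /mapP[p ps ->]; exact: (sf (j :: a) aN p ps).
  rewrite inner_orthonormal_tau//; apply: eq_bigr => g _.
  by rewrite tensor_coord_map.
have -> : mass_upto (fun a => tensor_sum (s a)) N.+1 =
    \sum_(g <- f) mass_upto (fun a => tensor_coord (s a) g) N.+1.
  rewrite /mass_upto [RHS]exchange_big; apply: eq_big_seq => a; rewrite mem_words ltnS => aN.
  apply: complexI; rewrite -innerxx sE// inner_orthonormal_tau// rmorph_sum.
  by apply: eq_bigr => g _; rewrite innerxx.
rewrite (le_trans (rnorm_sum _ _ _))// mulr_sumr; apply: ler_sum => g _.
exact: radius_form_bounded.
Qed.

Lemma radius_tensor_le : joint_numerical_radius S <= joint_numerical_radius T.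
Proof.
apply: radius_le => [|h N]; first exact: radius_ge0.
(* Each [h a] is a limit of tensor sums. Finitely many of them enter the truncated form and mass, so
   the inequality passes to the limit. *)
have /choice[s sP] (a : word) : exists s : nat -> seq (E * H),
    rcvg (fun m => tensor_sum (s m)) (h a).
  have /choice[s sP] (m : nat) : exists s, rnorm (tensor_sum s - h a) < m.+1%:R^-1.
    by apply: tensor_sum_dense; rewrite invr_gt0.
  by exists s; apply: rcvg_inv => m; exact/ltW.
apply: (@le_rcvg _ (fun m => rnorm (form_upto S (fun a => tensor_sum (s a m)) N))
  (fun m => joint_numerical_radius T * mass_upto (fun a => tensor_sum (s a m)) N.+1)).
- apply: rcvg_rnorm; apply: rcvg_sum => a; apply: rcvg_sum => j.
  by apply: rcvg_inner => //; exact: rcvg_bop.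
- apply: cvgM; first exact: cvg_cst.
  apply: cvg_big => [|a _]; first exact: add_continuous.
  by rewrite expr2; under eq_fun do rewrite expr2; apply: cvgM; exact: rcvg_rnorm.
- by move=> m; exact: form_tensor_sum.
Qed.

(** For a unit vector [e], the map [tau e] is an isometry [V], and compressing [S j] by [V] gives
    back [T j]; [radius_conj_le] then applies. *)
Lemma radius_tensor_ge : joint_numerical_radius T <= joint_numerical_radius S.
Proof.
have [x x0] := @hilbert_nonzero R E.
have xn0 : rnorm x != 0 by rewrite rnorm_eq0.
pose e := (rnorm x)^-1%:C%C *: x.
have e1 : inner e e = 1 :> C.
  rewrite innerxx /e rnormZ rnorm_real ?invr_ge0 ?rnorm_ge0// mulVf//.
  by rewrite expr1n.
have tau_e h : rnorm (tau e h) = rnorm h.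
  apply/eqP; rewrite -(eqrXn2 (n := 2)) ?rnorm_ge0//; apply/eqP/complexI.
  by rewrite -!innerxx inner_tau e1 mul1r.
have Vb : (tau e : H -> G) \in @bounded_op R H G.
  apply/bounded_opP; split=> [a u v|]; first by rewrite linearDr linearZr_LR.
  by exists 1 => h; rewrite tau_e mul1r.
pose V := Bop Vb.
have {1}-> : T = fun j => adjoint V \oB S j \oB V.
  apply/funext => j; apply/bopP => h; apply: inner_inj => z.
  by rewrite /= -adjointP /= tensor_opP inner_tau e1 mul1r.
rewrite (le_trans (radius_conj_le _ _))// ler_piMl ?radius_ge0//.
rewrite expr_le1 ?rnorm_ge0//; apply: opnorm_le => // h.
by rewrite /= tau_e mul1r.
Qed.

Lemma radius_tensor : joint_numerical_radius S = joint_numerical_radius T.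
Proof. by apply/le_anti; rewrite radius_tensor_le radius_tensor_ge. Qed.

End tensor.

(** * The nine properties together *)

Unset Implicit Arguments.
Set Strict Implicit.

Theorem theorem1p1 (R : realType) (n : nat) (hn : (0 < n)%N)
    (H : hilbertType R) :
  let w (K : hilbertType R) (T : 'I_n -> {bop K -> K}) :=
    joint_numerical_radius T in
  (forall T : 'I_n -> {bop H -> H},
    has_sup (joint_numerical_values T) /\ 0 <= w H T) /\
  (* (i) *)
  (forall T : 'I_n -> {bop H -> H}, w H T = 0 <-> forall j, T j = 0) /\
  (* (ii) *)
  (forall (T : 'I_n -> {bop H -> H}) (l : R[i]),
    w H (fun j => l *: T j) = rnorm l * w H T) /\
  (* (iii) *)
  (forall T T' : 'I_n -> {bop H -> H},
    w H (fun j => T j + T' j) <= w H T + w H T') /\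
  (* (iv) *)
  (forall (T : 'I_n -> {bop H -> H}) (K : hilbertType R) (U : {bop K -> H}),
    unitary U -> w K (fun j => adjoint U \oB T j \oB U) = w H T) /\
  (* (v) *)
  (forall (T : 'I_n -> {bop H -> H}) (K : hilbertType R) (X : {bop K -> H}),
    w K (fun j => adjoint X \oB T j \oB X) <= rnorm X ^+ 2 * w H T) /\
  (* (vi) *)
  (forall T : 'I_n -> {bop H -> H},
    2^-1 * Num.sqrt (rnorm (\sum_(i < n) T i \oB adjoint (T i))) <= w H T /\
    w H T <= Num.sqrt (rnorm (\sum_(i < n) T i \oB adjoint (T i)))) /\
  (* (vii) *)
  (forall T : 'I_n -> {bop H -> H},
    cvgn (joint_spectral_seq T) /\ joint_spectral_radius T <= w H T) /\
  (* (viii) *)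
  (forall (T : 'I_n -> {bop H -> H}) (E G : hilbertType R)
      (tau : {bilinear E -> H -> G}),
    separable E -> is_tensor_product tau ->
    w G (fun j => tensor_op tau (bop_id E) (T j)) = w H T) /\
  (* (ix) *)
  continuous (fun T : {ptws 'I_n -> {bop H -> H}} => w H T).
Proof.
move=> w; split; first by move=> T; split; [exact: has_sup_values|exact: radius_ge0].
split; first exact: radius_eq0.
split; first exact: radiusZ.
split; first exact: radiusD.
split; first by move=> T K U; exact: radius_unitary.
split; first by move=> T K X; exact: radius_conj_le.
split; first by move=> T; split; [exact: row_norm_le_radius|exact: radius_le_row_norm].
split; first by move=> T; split; [exact: joint_spectral_seq_cvg|exact: joint_spectral_radius_le].
split; last exact: radius_continuous.
by move=> T E G tau _ tauP; exact: radius_tensor.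
Qed.
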